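(* Let $n,k,\ell$ be positive integers with $k\ge 2$, $\ell\ge 2$ and $n\ge 3.38\max\{k,\ell\}$. If $\mathcal{A}\subseteq\binom{[n]}{k}$ and $\mathcal{B}\subseteq\binom{[n]}{\ell}$ are cross-$2$-intersecting, then $$|\mathcal A||\mathcal B|\le \binom{n-2}{k-2}\binom{n-2}{\ell-2}.$$ Moreover, equality holds if and only if there is a $2$-subset $T$ of $[n]$ such that $\mathcal A=\{A\in\binom{[n]}{k}: T\subset A\}$ and $\mathcal B=\{B\in\binom{[n]}{\ell}: T\subset B\}$.
   Context: $[n]=\{1,\dots,n\}$ and $\binom{[n]}{k}$ denotes the family of all $k$-element subsets of $[n]$. Two families $\mathcal A,\mathcal B$ of subsets of $[n]$ are cross-$2$-intersecting if $|A\cap B|\ge 2$ for all $A\in\mathcal A$, $B\in\mathcal B$. *)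

(* Defs.v *)
From mathcomp Require Import all_boot all_order all_algebra.

Set Implicit Arguments.
Unset Strict Implicit.
Unset Printing Implicit Defensive.

(* The ground set [n] = {1, ..., n} is represented by 'I_n = {0, ..., n-1}. *)

Definition ksubsets (n k : nat) : {set {set 'I_n}} :=
  [set A : {set 'I_n} | #|A| == k].

Definition cross_intersecting (n t : nat) (AA BB : {set {set 'I_n}}) : Prop :=
  forall A B : {set 'I_n}, A \in AA -> B \in BB -> t <= #|A :&: B|.

(* Main.v *)
From Stdlib Require Import ZArith Lia.
Require Import Defs.
From mathcomp Require Import all_boot all_order all_algebra.
From mathcomp Require Import zify ring.

Set Implicit Arguments.
Unset Strict Implicit.
Unset Printing Implicit Defensive.

(* Take a pair of maximal product, shifted to the left, and let [m] be minimal
   such that membership in both families only depends on the trace on [[m]].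
   Traces on [[m]] are again cross-2-intersecting.  Let [D] and [F] be subsets of
   [[m-1]] whose membership status as traces changes when [m] is added.  If
   [D + m] and [F + m] meet in only two points, then shifting [m] down shows that
   [D] and [F] cover [[m-1]], so [|D| + |F| = m].  Hence, for [s + t = m], one may
   add to A all sets with trace such an [s]-set [D], at the price of removing from
   B the sets with trace [F + m], [|F| = t].  Since neither this exchange nor the
   reverse one increases the product, |A| is bounded above in terms of the number
   of the [s]-sets [D]; the upper shadow of these sets, which is contained in the
   traces of A, bounds |A| below.  For n >= 3.38 max(k, l) the two bounds, and
   their analogues for B, leave only [s, t <= 2], hence [m <= 4]
   ([s = t = 3] needs the shadow two levels up).  The case [m = 2] is the star;
   [m = 3] and [m = 4] are excluded by counting.  Finally, a pair whose shift is a
   star is itself a star, because the disjointness graph between (k-2)-subsets and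
   (l-2)-subsets of the remaining n-3 points is connected. *)

(** * Numerical estimates *)

Section Numerics.
Local Open Scope Z_scope.
Local Notation "x <= y" := (Z.le x y) : Z_scope.
Local Notation "x < y" := (Z.lt x y) : Z_scope.
Implicit Types n k l s : Z.

(* Here and in the next two lemmas the difference of the two sides is a polynomial with
   nonnegative coefficients in the slacks of the hypotheses. *)
Lemma num_4_4 n k l W p q r x y : 338 * k <= 100 * n -> 338 * l <= 100 * n ->
  4 <= k -> 4 <= l -> n - k - l + 1 = W -> n - k - 1 = p -> n - k = q ->
  n - 5 = r -> k - 4 = x -> l - 3 = y ->
  10 * y * p * q < r * W * (5 * q + x).
Proof.
intros hk hl k4 l4 <- <- <- <- <- <-.
(* From k >= 4 one gets 100 n >= 1352, hence n >= 14. *)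
assert (hd : 0 <= n - 14) by lia.
set (d := n - 14) in *; set (u := 100 * n - 338 * k).
set (v := 100 * n - 338 * l).
assert (hu : 0 <= u) by lia; assert (hv : 0 <= v) by lia.
(* With [k = (100 n - u) / 338] and [l = (100 n - v) / 338], the factor 338^3 clears the
   denominators of the cubic inequality. *)
apply (Zmult_lt_reg_r _ _ (338 * 338 * 338)); [lia|].
apply Z.lt_0_sub.
replace (_ - _) with
  ((76867029840 + 12953642568 * d + 586396352 * (d * d)
    + 3526760 * (d * d * d) + 146596 * (d * d * u) + 6156348 * (d * u)
    + 352 * (d * (u * u)) + 54028736 * u + 8308 * (u * u))
   + 338 * (v * ((d + 9) * (1290 * n + 4 * u - 1352)
                 + 10 * (n - k - 1) * (238 * n + u))))
  by (unfold d, u, v; ring).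
assert (0 <= v * ((d + 9) * (1290 * n + 4 * u - 1352)
                 + 10 * (n - k - 1) * (238 * n + u))).
  apply Z.mul_nonneg_nonneg; [lia|].
  apply Z.add_nonneg_nonneg; repeat apply Z.mul_nonneg_nonneg; lia.
assert (0 <= d * d) by (apply Z.mul_nonneg_nonneg; lia).
assert (0 <= d * d * d) by (apply Z.mul_nonneg_nonneg; lia).
assert (0 <= d * d * u) by (apply Z.mul_nonneg_nonneg; lia).
assert (0 <= d * u) by (apply Z.mul_nonneg_nonneg; lia).
assert (0 <= u * u) by (apply Z.mul_nonneg_nonneg; lia).
assert (0 <= d * (u * u)) by (apply Z.mul_nonneg_nonneg; lia).
lia.
Qed.

Lemma num_4_3 n k l : 338 * k <= 100 * n -> 338 * l <= 100 * n ->
  4 <= k ->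
  3 * ((n - l - 1) * (k - 3)) < 2 * ((n - 4) * (n - k - l + 1)).
Proof.
intros hk hl k4.
assert (hd : 0 <= n - 14) by lia.
set (d := n - 14) in *; set (u := 100 * n - 338 * k).
set (v := 100 * n - 338 * l).
assert (hu : 0 <= u) by lia; assert (hv : 0 <= v) by lia.
apply (Zmult_lt_reg_r _ _ (338 * 338)); [lia|].
apply Z.lt_0_sub.
replace (_ - _) with
  (11878148 + 1293596 * d + 21888 * (d * d) + 1390 * (d * u) + 376 * (d * v)
   + 15742 * u + 3 * (u * v) + 5602 * v)
  by (unfold d, u, v; ring).
assert (0 <= d * d) by (apply Z.mul_nonneg_nonneg; lia).
assert (0 <= d * u) by (apply Z.mul_nonneg_nonneg; lia).
assert (0 <= d * v) by (apply Z.mul_nonneg_nonneg; lia).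
assert (0 <= u * v) by (apply Z.mul_nonneg_nonneg; lia).
lia.
Qed.

Lemma num_diag n k l s : 338 * k <= 100 * n -> 338 * l <= 100 * n ->
  4 <= s -> s < k ->
  5 * ((n + 2 - l - s) * (k - s)) < 3 * ((n + 1 - 2 * s) * (n - k - l + 1)).
Proof.
intros hk hl s4 sk.
assert (hd : 0 <= s - 4) by lia.
set (d := s - 4) in *; set (u := 100 * n - 338 * k).
set (v := 100 * n - 338 * l); set (w := 100 * n - 338 * (s + 1)).
assert (hu : 0 <= u) by lia; assert (hv : 0 <= v) by lia.
assert (hw : 0 <= w) by lia.
(* The factor is the square of 16900, the least common multiple of 100 and 338, which clears the
   denominators of a quadratic in [d], [u], [v], [w]. *)
apply (Zmult_lt_reg_r _ _ (10000 * 28561)); [lia|].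
apply Z.lt_0_sub.
replace (_ - _) with
  (28561 * (1851300 + 667920 * d + 57132 * (d * d))
   + 169 * (55200 * (d * u) + 20700 * (d * v) + 64032 * (d * w)
            + 396000 * u + 298460 * w + 123500 * v)
   + 12500 * (u * v) + 55100 * (u * w) + 12850 * (v * w) + 5233 * (w * w))
  by (unfold d, u, v, w; ring).
assert (0 <= d * d) by (apply Z.mul_nonneg_nonneg; lia).
assert (0 <= d * u) by (apply Z.mul_nonneg_nonneg; lia).
assert (0 <= d * v) by (apply Z.mul_nonneg_nonneg; lia).
assert (0 <= d * w) by (apply Z.mul_nonneg_nonneg; lia).
assert (0 <= u * v) by (apply Z.mul_nonneg_nonneg; lia).
assert (0 <= u * w) by (apply Z.mul_nonneg_nonneg; lia).
assert (0 <= v * w) by (apply Z.mul_nonneg_nonneg; lia).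
assert (0 <= w * w) by (apply Z.mul_nonneg_nonneg; lia).
lia.
Qed.

(** For [s > 1] the last hypothesis says that [(t + 1) / (s - 1)] is at least [p W / (q r)]. This
    quotient exceeds 1 and 4/3 in general, 3/2 for [(s, t) = (3, 2)] and 5/3 for [s = t >= 4], which
    leaves four pairs. Differences are passed as variables with equations, so that truncated
    differences of natural numbers can be substituted. *)
Lemma num_large n k l s t s1 W p q r :
  338 * k <= 100 * n -> 338 * l <= 100 * n ->
  1 <= t -> t <= s -> s < k -> t < l ->
  s - 1 = s1 -> n - k - l + 1 = W -> n + 1 - s - t = p -> n + 2 - l - s = q ->
  k - s = r -> W * (s1 * p) <= (t + 1) * (q * r) ->
  s = 1 /\ t = 1 \/ s = 2 /\ t = 1 \/ s = 2 /\ t = 2 \/ s = 3 /\ t = 3.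
Proof.
intros hk hl ht hts hsk htl <- <- <- <- <- H.
set (W := n - k - l + 1) in *.
set (p := n + 1 - s - t) in *; set (q := n + 2 - l - s) in *; set (r := k - s) in *.
assert (hq : 0 < q) by lia; assert (hp : q <= p) by lia; assert (hr : 0 < r) by lia.
assert (hW : r < W) by lia; assert (hW3 : 4 * r < 3 * W) by lia.
assert (hqr : 0 < q * r) by (apply Z.mul_pos_pos; lia).
assert (H' : (s - 1) * (p * W) <= (t + 1) * (q * r)).
  replace ((s - 1) * (p * W)) with (W * ((s - 1) * p)) by ring; exact H.
assert (hpr : q * r <= p * r) by (apply Z.mul_le_mono_nonneg_r; lia).
assert (hprW : p * r < p * W) by (apply Z.mul_lt_mono_pos_l; lia).
assert (hprW4 : p * (4 * r) < p * (3 * W)) by (apply Z.mul_lt_mono_pos_l; lia).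
assert (key : forall x y, 0 < y -> 1 < s -> y * (t + 1) <= x * (s - 1) ->
          x * (q * r) < y * (p * W) -> False).
  intros x y hy hs hxy hlt.
  assert (h1 : y * ((s - 1) * (p * W)) <= y * ((t + 1) * (q * r))).
    apply Z.mul_le_mono_nonneg_l; lia.
  assert (h2 : (y * (t + 1)) * (q * r) <= (x * (s - 1)) * (q * r)).
    apply Z.mul_le_mono_nonneg_r; lia.
  assert (h3 : (s - 1) * (x * (q * r)) < (s - 1) * (y * (p * W))).
    apply Z.mul_lt_mono_pos_l; lia.
  lia.
destruct (Z.le_gt_cases (t + 2) s) as [hs|hs].
  exfalso; apply (key 1 1); lia.
destruct (Z.le_gt_cases (t + 1) s) as [hs1|hs1].
  assert (s = t + 1) by lia; subst s.
  destruct (Z.le_gt_cases 3 t) as [ht3|ht3].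
    exfalso; apply (key 4 3); lia.
  destruct (Z.eq_dec t 1) as [->|]; [lia|].
  assert (t = 2) by lia; subst t.
  exfalso; assert (h := @num_4_3 n k l hk hl ltac:(lia)).
  unfold p, q, r, W in H'; lia.
assert (t = s) by lia; subst t.
destruct (Z.le_gt_cases 4 s) as [hs4|hs4]; [exfalso|lia].
apply (key 5 3); try lia.
assert (h := @num_diag n k l s hk hl hs4 hsk).
unfold p, q, r, W; lia.
Qed.

Lemma num_star n k l W p q x y z : 338 * k <= 100 * n -> 338 * l <= 100 * n ->
  2 <= k -> 2 <= l -> n - k - l + 1 = W -> n - k - 1 = p -> n - k = q ->
  k - 2 = x -> n - 2 = y -> n - 3 = z ->
  2 * (x * q * p) < y * z * W.
Proof.
intros hk hl k2 l2 <- <- <- <- <- <-.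
set (W := n - k - l + 1).
(* The factors [k - 2] and [n - k] have sum [n - 2]. *)
assert (amgm : 4 * ((k - 2) * (n - k)) <= (n - 2) * (n - 2)).
  assert (0 <= (n - 2 * k + 2) * (n - 2 * k + 2)) by apply Z.square_nonneg.
  lia.
assert (h1 : 4 * ((k - 2) * (n - k)) * (n - k - 1) <= (n - 2) * (n - 2) * (n - k - 1)).
  apply Z.mul_le_mono_nonneg_r; lia.
assert (h2 : (n - 3) * 3 <= (n - 3) * (2 * W - (n - k - 1))).
  apply Z.mul_le_mono_nonneg_l; unfold W; lia.
assert (h3 : (n - 2) * ((n - 2) * (n - k - 1)) < (n - 2) * ((n - 3) * (2 * W))).
  apply Z.mul_lt_mono_pos_l; lia.
lia.
Qed.

End Numerics.

Lemma levels_large (n k l s t : nat) : 338 * k <= 100 * n -> 338 * l <= 100 * n ->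
  0 < t -> t <= s -> s < k -> t < l ->
  (n.+1 - k - l) * (s.-1 * (n.+1 - s - t)) <= t.+1 * ((n.+2 - l - s) * (k - s)) ->
  (s, t) \in [:: (1, 1); (2, 1); (2, 2); (3, 3)].
Proof.
move=> hk hl t0 lets ltsk lttl le_st.
have large : Z.of_nat s = Z.of_nat 1 /\ Z.of_nat t = Z.of_nat 1 \/
    Z.of_nat s = Z.of_nat 2 /\ Z.of_nat t = Z.of_nat 1 \/
    Z.of_nat s = Z.of_nat 2 /\ Z.of_nat t = Z.of_nat 2 \/
    Z.of_nat s = Z.of_nat 3 /\ Z.of_nat t = Z.of_nat 3.
  apply: (@num_large (Z.of_nat n) (Z.of_nat k) (Z.of_nat l) _ _
    (Z.of_nat s.-1) (Z.of_nat (n.+1 - k - l)) (Z.of_nat (n.+1 - s - t))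
    (Z.of_nat (n.+2 - l - s)) (Z.of_nat (k - s))); try (clear le_st; lia).
  move: (n.+1 - k - l) (n.+1 - s - t) (n.+2 - l - s) (k - s) s.-1 le_st.
  by clear => W p q r s1 le_st; lia.
have {large} : s = 1 /\ t = 1 \/ s = 2 /\ t = 1 \/ s = 2 /\ t = 2 \/ s = 3 /\ t = 3.
  by move: large; clear; lia.
by case=> [[-> ->]|[[-> ->]|[[-> ->]|[-> ->]]]].
Qed.

Lemma level_4_4 (n k l : nat) : 338 * k <= 100 * n -> 338 * l <= 100 * n ->
  3 < k -> 3 < l ->
  10 * ((l - 3) * (n - k - 1) * (n - k))
    < (n.+1 - k - l) * ((n - 5) * (5 * (n - k) + (k - 4))).
Proof.
move=> hk hl k4 l4.
have := @num_4_4 (Z.of_nat n) (Z.of_nat k) (Z.of_nat l) (Z.of_nat (n.+1 - k - l))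
  (Z.of_nat (n - k - 1)) (Z.of_nat (n - k)) (Z.of_nat (n - 5)) (Z.of_nat (k - 4))
  (Z.of_nat (l - 3)).
move=> /(_ ltac:(lia) ltac:(lia) ltac:(lia) ltac:(lia) ltac:(lia) ltac:(lia) ltac:(lia)
  ltac:(lia) ltac:(lia) ltac:(lia)).
by move: (n.+1 - k - l) (n - k - 1) (n - k) (n - 5) (k - 4) (l - 3) => *; lia.
Qed.

Lemma level_star (n k l : nat) : 338 * k <= 100 * n -> 338 * l <= 100 * n ->
  1 < k -> 1 < l ->
  2 * ((k - 2) * (n - k) * (n - k - 1)) < (n - 2) * (n - 3) * (n.+1 - k - l).
Proof.
move=> hk hl k2 l2.
have := @num_star (Z.of_nat n) (Z.of_nat k) (Z.of_nat l) (Z.of_nat (n.+1 - k - l))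
  (Z.of_nat (n - k - 1)) (Z.of_nat (n - k)) (Z.of_nat (k - 2)) (Z.of_nat (n - 2))
  (Z.of_nat (n - 3)).
move=> /(_ ltac:(lia) ltac:(lia) ltac:(lia) ltac:(lia) ltac:(lia) ltac:(lia) ltac:(lia)
  ltac:(lia) ltac:(lia) ltac:(lia)).
by move: (n.+1 - k - l) (n - k - 1) (n - k) (k - 2) (n - 2) (n - 3) => *; lia.
Qed.

(** * Traces of shifted families *)

Section FiniteSets.
Variable T : finType.
Implicit Types (A B U V : {set T}) (GG : {set {set T}}).

Lemma subset_between U V s :
  U \subset V -> #|U| <= s <= #|V| ->
  exists2 Z : {set T}, (U \subset Z) && (Z \subset V) & #|Z| = s.
Proof.
move=> sUV /andP[leUs lesV].
have : 0 < #|[set A : {set T} | A \subset V :\: U & #|A| == s - #|U|]|.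
  rewrite cards_draws bin_gt0 cardsD (setIidPr sUV).
  by rewrite leq_sub2r.
case/card_gt0P=> A; rewrite inE => /andP[/subsetDP[sAV dAU] /eqP cA].
exists (U :|: A); first by rewrite subsetUl subUset sUV sAV.
rewrite cardsU setIC (disjoint_setI0 dAU) cards0 subn0 cA.
by rewrite subnKC.
Qed.

(** Such a set is a member of [GG] together with a free choice of [k - s] points outside [U]. *)
Lemma card_trace U GG s k :
  (forall E, E \in GG -> E \subset U /\ #|E| = s) -> s <= k ->
  #|[set A : {set T} | (#|A| == k) && (A :&: U \in GG)]|
    = #|GG| * 'C(#|T| - #|U|, k - s).
Proof.
move=> GGP lesk.
rewrite -sum1_card (partition_big (fun A => A :&: U) (mem GG)) /=; last first.
  by move=> A; rewrite inE => /andP[].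
rewrite -sum_nat_const; apply: eq_bigr => E EG.
have [sEU cE] := GGP E EG.
have cU : #|~: U| = #|T| - #|U| by rewrite -(cardsC U) addKn.
pose draws := [set F : {set T} | F \subset ~: U & #|F| == k - s].
have injE : {in draws &, injective (fun F => E :|: F)}.
  move=> F G; rewrite !inE => /andP[sF _] /andP[sG _] eqEFG.
  have key (H : {set T}) : H \subset ~: U -> (E :|: H) :\: U = H.
    move=> sH; rewrite setDUl; have -> : E :\: U = set0.
      by apply/eqP; rewrite setD_eq0.
    by rewrite set0U; apply/setDidPl; rewrite disjoints_subset.
  by rewrite -(key F) // -(key G) // eqEFG.
rewrite sum1_card -cU -cards_draws -/draws -(card_in_imset injE).
apply: eq_card => A; rewrite unfold_in /= inE.
apply/andP/imsetP.
  case=> /andP[/eqP cA _] /eqP trA; exists (A :\: U).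
    rewrite inE subsetDr cardsD trA cA cE eqxx //.
  by rewrite -trA setID.
case=> F; rewrite inE => /andP[sF /eqP cF] ->.
have FU : F :&: U = set0 by apply/disjoint_setI0; rewrite disjoints_subset.
have EF : E :&: F = set0.
  by apply/eqP; rewrite -subset0 -FU setIC setIS.
have tr : (E :|: F) :&: U = E by rewrite setIUl FU setU0; apply/setIidPl.
by rewrite tr EG cardsU EF cards0 subn0 cE cF subnKC // !eqxx.
Qed.

End FiniteSets.

Lemma card_swap (T : finType) (x y : T) (A : {set T}) :
  y \in A -> x \notin A -> #|x |: (A :\ y)| = #|A|.
Proof.
move=> yA xA; rewrite cardsU1 !inE (negbTE xA) andbF.
by rewrite (cardsD1 y A) yA.
Qed.

Definition init n m : {set 'I_n} := [set x : 'I_n | x < m].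

Lemma card_init n m : m <= n -> #|init n m| = m.
Proof.
move=> le_mn; have injw : injective (widen_ord le_mn).
  by move=> x y /(congr1 val) /= /val_inj.
rewrite -[RHS]card_ord -cardsT -(card_imset _ injw).
apply: eq_card => x; rewrite !inE; apply/idP/imsetP => [xm | [y _ ->]].
  by exists (Ordinal xm); rewrite ?inE //; apply: val_inj.
exact: (ltn_ord y).
Qed.

Definition shifted n (FF : {set {set 'I_n}}) :=
  forall (x y : 'I_n) (A : {set 'I_n}), x < y -> A \in FF ->
    y \in A -> x \notin A -> x |: (A :\ y) \in FF.

(** Induction on [#|B :\: A|]: each shift replaces a point of [A :\: B] by a smaller one of
    [B :\: A]. *)
Lemma shifted_below n (FF : {set {set 'I_n}}) (A B : {set 'I_n}) :
  shifted FF -> A \in FF -> #|A| = #|B| ->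
  (forall x y, x \in B :\: A -> y \in A :\: B -> x < y) -> B \in FF.
Proof.
move=> shF; move: {2}#|B :\: A| (erefl #|B :\: A|) => d.
elim: d A => [|d IHd] A cBA AF cAB lt_BA.
  suff -> : B = A by [].
  by apply/eqP; rewrite eqEcard cAB leqnn andbT -setD_eq0 -cards_eq0 cBA.
have cAB' : #|A :\: B| = d.+1.
  by apply/eqP; rewrite -cBA !cardsD cAB setIC.
have /card_gt0P[x xBA] : 0 < #|B :\: A| by rewrite cBA.
have /card_gt0P[y yAB] : 0 < #|A :\: B| by rewrite cAB'.
have ltxy := lt_BA _ _ xBA yAB.
move: (xBA) (yAB); rewrite !inE => /andP[xA xB] /andP[yB yA].
apply: (IHd (x |: (A :\ y))).
- have -> : B :\: (x |: (A :\ y)) = (B :\: A) :\ x.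
    apply/setP => z; rewrite !inE; case: (eqVneq z y) => [->|_] /=; last first.
      by case: (z == x).
    by rewrite (negbTE yB) !andbF.
  by move: cBA; rewrite (cardsD1 x) xBA => -[].
- exact: shF.
- by rewrite card_swap.
- move=> u v; rewrite !inE => /andP[]; rewrite negb_or => /andP[ux uA] uB.
  case/andP=> vB vxA; apply: lt_BA.
    rewrite inE uB andbT; apply: contraNN uA => ->; rewrite andbT.
    by apply: contraNneq yB => <-.
  rewrite inE vB; case/orP: vxA => [/eqP vx|/andP[]//].
  by rewrite vx xB in vB.
Qed.

(** Boolean, so that the least [m] with this property can be selected by [ex_minnP]. *)
Definition determined n k (FF : {set {set 'I_n}}) m :=
  [forall A in FF, forall B : {set 'I_n},
    (#|B| == k) && (A :&: init n m == B :&: init n m) ==> (B \in FF)].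

Lemma determinedP n k (FF : {set {set 'I_n}}) m :
  reflect (forall A B : {set 'I_n}, A \in FF -> #|B| = k ->
             A :&: init n m = B :&: init n m -> B \in FF)
          (determined k FF m).
Proof.
apply: (iffP forall_inP) => [dF A B AF cB trAB | dF A AF].
  by have /forallP/(_ B)/implyP := dF A AF; apply; rewrite cB trAB !eqxx.
apply/forallP => B; apply/implyP => /andP[/eqP cB /eqP trAB].
exact: dF AF cB trAB.
Qed.

Lemma card_ksubsets n k (FF : {set {set 'I_n}}) (A : {set 'I_n}) :
  FF \subset ksubsets n k -> A \in FF -> #|A| = k.
Proof. by move=> /subsetP sF /sF; rewrite inE => /eqP. Qed.

Lemma determined_full n k (FF : {set {set 'I_n}}) : determined k FF n.
Proof.
apply/determinedP => A B AF _; have -> : init n n = setT.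
  by apply/setP => x; rewrite !inE ltn_ord.
by rewrite !setIT => <-.
Qed.

Section UniformShifted.
Variables (n k m : nat) (FF : {set {set 'I_n}}).
Hypotheses (uF : FF \subset ksubsets n k) (shF : shifted FF).
Hypothesis dF : determined k FF m.

(** Outside [init n m], [A] may be replaced by any set of the same size, in particular by one
    containing all points of [B] there. Then [B] arises by moving points [>= m] to points [< m],
    which shiftedness allows. *)
Lemma trace_up (A B : {set 'I_n}) :
  A \in FF -> #|B| = k -> A :&: init n m \subset B -> B \in FF.
Proof.
move=> AF cB sAB; have cA := card_ksubsets uF AF.
set I := init n m in sAB *.
have trB : #|B :\: I| <= #|A :\: I| <= #|~: I|.
  rewrite (subset_leq_card (subsetDr A I)) andbT !cardsD cA cB leq_sub2l //.
  by rewrite subset_leq_card // subsetI sAB subsetIr.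
have [Z /andP[sBZ sZI] cZ] := subset_between (subsetDr B I) trB.
have ZI : Z :&: I = set0 by apply/disjoint_setI0; rewrite disjoints_subset.
pose A0 := A :&: I :|: Z.
have trA0 : A :&: I = A0 :&: I by rewrite setIUl ZI setU0 -setIA setIid.
have cA0 : #|A0| = k.
  rewrite cardsU -setIA [I :&: Z]setIC ZI setI0 cards0 subn0 cZ cardsD cA.
  by rewrite subnKC // -cA subset_leq_card // subsetIl.
have A0F : A0 \in FF by move/determinedP: dF; apply; first exact: AF.
apply: (shifted_below shF A0F); first by rewrite cA0.
move=> x y; rewrite !inE => /andP[]; rewrite negb_or => /andP[_ xZ] xB.
case/andP=> yB yA0; have xI : x \in I.
  by apply: contraNT xZ => xI; apply: (subsetP sBZ); rewrite inE xI.
have yI : y \notin I.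
  case/orP: yA0 => [yAI | yZ]; last by have := subsetP sZI _ yZ; rewrite inE.
  by case/negP: yB; apply: (subsetP sAB); rewrite !inE.
move: xI yI; rewrite !inE -leqNgt; exact: leq_trans.
Qed.

Lemma trace_full (A B : {set 'I_n}) :
  A \in FF -> #|B| = k -> A :&: init n m = B :&: init n m -> B \in FF.
Proof. by move=> AF cB trAB; move/determinedP: dF; apply; first exact: AF. Qed.

End UniformShifted.

(** A common point [z >= m] can be replaced in [A] by a point [w] outside both sets, available
    because [k + l <= n]. If [w < m] this is a shift, otherwise the trace is unchanged; either way
    the new set is in [AA], and the common points below [m] stay the same. *)
Lemma trace_cross n k l m (AA BB : {set {set 'I_n}}) (A B : {set 'I_n}) :
  k + l <= n -> AA \subset ksubsets n k -> BB \subset ksubsets n l ->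
  shifted AA -> determined k AA m -> cross_intersecting 2 AA BB ->
  A \in AA -> B \in BB -> 2 <= #|A :&: B :&: init n m|.
Proof.
move=> le_kl uA uB shA dA cr AF BF; have cB := card_ksubsets uB BF.
move: {2}#|_ :\: _| (erefl #|A :&: B :\: init n m|) => d.
elim: d A AF => [|d IHd] A AF cd; have cA := card_ksubsets uA AF.
  have -> : A :&: B :&: init n m = A :&: B.
    by apply/setIidPl; rewrite -setD_eq0 -cards_eq0 cd.
  exact: cr.
have /card_gt0P[z] : 0 < #|A :&: B :\: init n m| by rewrite cd.
rewrite !inE => /andP[zI /andP[zA zB]].
have /card_gt0P[w] : 0 < #|~: (A :|: B)|.
  have AB0 : 0 < #|A :&: B| by apply/card_gt0P; exists z; rewrite inE zA.
  rewrite -(ltn_add2l #|A :|: B|) addn0 cardsC card_ord cardsU cA cB.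
  by apply: leq_ltn_trans (leq_sub2l _ AB0) _; have := ltn_ord z; lia.
rewrite !inE negb_or => /andP[wA wB].
have swapE : (w |: (A :\ z)) :&: B = (A :&: B) :\ z.
  apply/setP => v; rewrite !inE; case: (eqVneq v w) => [->|_] /=.
    by rewrite (negbTE wB) !andbF.
  by rewrite andbA.
have AwF : w |: (A :\ z) \in AA.
  case: (ltnP w m) => [wm | mw].
    by apply: shA => //; apply: leq_trans wm _; rewrite leqNgt.
  apply: (trace_full dA AF); first by rewrite card_swap.
  apply/setP => v; rewrite !inE; case: (ltnP v m) => vm; rewrite ?andbF // !andbT.
  have -> : (v == w) = false by apply/eqP => vw; move: vm; rewrite vw; lia.
  have -> // : v != z by apply: contraNneq zI => <-.
have := IHd _ AwF; rewrite swapE.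
have -> : ((A :&: B) :\ z) :&: init n m = A :&: B :&: init n m.
  apply/setP => v; rewrite !inE; case: (eqVneq v z) => [->|] //=.
  by rewrite (negbTE zI) andbF.
apply.
by move: cd; rewrite (cardsD1 z) !inE zA zB zI /= => -[<-]; rewrite setDDl setUC -setDDl.
Qed.

(** * Exchanging boundary sets *)

Definition admissible n k l (AA BB : {set {set 'I_n}}) : Prop :=
  [/\ AA \subset ksubsets n k, BB \subset ksubsets n l
    & cross_intersecting 2 AA BB].

Definition optimal n k l (AA BB : {set {set 'I_n}}) : Prop :=
  admissible k l AA BB /\
  forall AA' BB' : {set {set 'I_n}}, admissible k l AA' BB' ->
    #|AA'| * #|BB'| <= #|AA| * #|BB|.

Lemma cross_sym n t (AA BB : {set {set 'I_n}}) :
  cross_intersecting t AA BB -> cross_intersecting t BB AA.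
Proof. by move=> cr B A BF AF; rewrite setIC cr. Qed.

Lemma admissible_sym n k l (AA BB : {set {set 'I_n}}) :
  admissible k l AA BB -> admissible l k BB AA.
Proof. by case=> uA uB /cross_sym cr. Qed.

Lemma optimal_sym n k l (AA BB : {set {set 'I_n}}) :
  optimal k l AA BB -> optimal l k BB AA.
Proof.
case=> /admissible_sym adm max; split=> // AA' BB' /admissible_sym /max.
by rewrite mulnC [X in _ <= X]mulnC.
Qed.

Definition traces n (FF : {set {set 'I_n}}) m :=
  [set A :&: init n m | A in FF].

(* With [m = c + 1], these are the [s]-subsets [D] of [[c]] such that membership
   of a set [A] with [A :&: [c] = D] really depends on whether [c] is in [A]. *)
Definition boundary n (FF : {set {set 'I_n}}) (c : 'I_n) s :=
  [set D : {set 'I_n} | [&& D \subset init n c, #|D| == s,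
     c |: D \in traces FF c.+1 & D \notin traces FF c.+1]].

Lemma initS n (c : 'I_n) : init n c.+1 = c |: init n c.
Proof. by apply/setP => x; rewrite !inE ltnS leq_eqVlt. Qed.

Lemma traceS_in n (c : 'I_n) (A : {set 'I_n}) :
  c \in A -> A :&: init n c.+1 = c |: (A :&: init n c).
Proof. by move=> cA; rewrite initS setIUr; have /setIidPr -> : [set c] \subset A by rewrite sub1set. Qed.

Lemma traceS_out n (c : 'I_n) (A : {set 'I_n}) :
  c \notin A -> A :&: init n c.+1 = A :&: init n c.
Proof.
move=> cA; rewrite initS setIUr; have -> : A :&: [set c] = set0; last by rewrite set0U.
by apply/disjoint_setI0; rewrite disjoint_sym disjoints1.
Qed.

Lemma init_notin n (c : 'I_n) : c \notin init n c.
Proof. by rewrite inE ltnn. Qed.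

Lemma trace_of_traceS n (c : 'I_n) (A D : {set 'I_n}) :
  D \subset init n c -> A :&: init n c.+1 = c |: D ->
  c \in A /\ A :&: init n c = D.
Proof.
move=> sD trA; have cA : c \in A.
  by have : c \in A :&: init n c.+1; [rewrite trA setU11 | rewrite inE => /andP[]].
split=> //; move: trA; rewrite traceS_in // => /(congr1 (fun E => E :\ c)).
rewrite !setU1K //; last by rewrite inE (negbTE (init_notin c)) andbF.
by apply: contraNN (init_notin c); exact: subsetP sD _.
Qed.

Section Boundary.
Variables (n k : nat) (c : 'I_n) (FF : {set {set 'I_n}}).
Hypotheses (uF : FF \subset ksubsets n k) (shF : shifted FF).
Hypothesis dF : determined k FF c.+1.

Lemma boundary_witness s (D : {set 'I_n}) : D \in boundary FF c s ->
  [/\ D \subset init n c, #|D| = s, D \notin traces FF c.+1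
    & exists A, [/\ A \in FF, c \in A & A :&: init n c = D]].
Proof.
rewrite inE => /and4P[sD /eqP cD /imsetP[A AF trA] ntD]; split=> //.
by exists A; have [] := trace_of_traceS sD (esym trA).
Qed.

(** A witness for [D] contains [c]; shifting [c] down to a point [e] of [B] outside [D] yields a
    member of [FF] whose trace, [D] with [e] added, lies in [B]. *)
Lemma boundary_up s (D B : {set 'I_n}) :
  D \in boundary FF c s -> #|B| = k -> D \subset B ->
  s < #|B :&: init n c| -> B \in FF.
Proof.
case/boundary_witness=> sDI cD _ [A [AF cA trA]] cB sDB lt_s.
have /card_gt0P[e] : 0 < #|B :&: init n c :\: D|.
  rewrite cardsD; have /setIidPr -> : D \subset B :&: init n c by rewrite subsetI sDB.
  by rewrite cD subn_gt0.
rewrite !inE => /and3P[eD eB ltec].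
have eA : e \notin A by apply: contraNN eD => eA; rewrite -trA !inE eA.
apply: (trace_up uF shF dF (shF ltec AF cA eA)) => //.
apply/subsetP => x; rewrite !inE => /andP[/orP[/eqP -> //|/andP[xc xA]]].
rewrite ltnS leq_eqVlt (inj_eq val_inj) (negbTE xc) => ltxc.
by apply: (subsetP sDB); rewrite -trA !inE xA.
Qed.

End Boundary.

Section Push.
Variables (n k l : nat) (c : 'I_n) (AA BB : {set {set 'I_n}}).
Hypothesis le_kl : k + l <= n.
Hypotheses (uA : AA \subset ksubsets n k) (shA : shifted AA).
Hypothesis dA : determined k AA c.+1.
Hypotheses (uB : BB \subset ksubsets n l) (cr : cross_intersecting 2 AA BB).

(** The sets share [c] and exactly one point below it. If some [x < c] were in neither, shifting [c]
    to [x] in [A] would leave a single common trace point. So they cover everything below [c], with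
    one point counted twice. *)
Lemma tight_pair (A B : {set 'I_n}) : A \in AA -> B \in BB -> c \in A -> c \in B ->
  #|A :&: B :&: init n c| < 2 ->
  #|A :&: init n c| + #|B :&: init n c| = c.+1.
Proof.
move=> AF BF cA cB lt2; have tr A' := trace_cross le_kl uA uB shA dA cr A' BF.
have trAB : A :&: B :&: init n c.+1 = c |: (A :&: B :&: init n c).
  by rewrite traceS_in // inE cA.
have cAB : #|A :&: B :&: init n c| = 1.
  apply/eqP; rewrite eqn_leq -ltnS lt2 -ltnS.
  have := tr _ AF; rewrite trAB cardsU1.
  by rewrite inE (negbTE (init_notin c)) andbF.
have cU : #|(A :|: B) :&: init n c| = c.
  rewrite -[RHS](@card_init n c) ?(ltnW (ltn_ord c)) //; congr #|pred_of_set _|.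
  apply/setIidPr/subsetP => x xI; apply: contraLR (leqnn 2).
  rewrite inE negb_or => /andP[xA xB]; have ltxc : x < c by rewrite inE in xI.
  have := tr _ (shA ltxc AF cA xA).
  have -> : (x |: A :\ c) :&: B :&: init n c.+1 = A :&: B :&: init n c.
    apply/setP => y; rewrite !inE; case: (eqVneq y x) => [->|_] /=.
      by rewrite (negbTE xB) !andbF.
    rewrite [y < c.+1]ltnS leq_eqVlt (inj_eq val_inj).
    by case: (eqVneq y c) => [->|]; rewrite ?ltnn ?andbF.
  by rewrite cAB.
by rewrite -cardsUI -setIUl -setIIl cU cAB addn1.
Qed.

Definition raise s :=
  AA :|: [set A : {set 'I_n} | (#|A| == k) && (A :&: init n c.+1 \in boundary AA c s)].
Definition lower t :=
  BB :\: [set B : {set 'I_n} | (#|B| == l) &&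
                 (B :&: init n c.+1 \in [set c |: F | F in boundary BB c t])].

(** An added [A] has a trace [D] without [c]; let [A1] be a witness for [D]. If [B] avoids [c], it
    meets [D] in the same points as the trace of [A1]. If [B] contains [c] and meets [D] in fewer
    than two points, [tight_pair] gives it [t] points below [c]; without [c] its trace would meet
    [A1] too little, so it is a boundary set plus [c], and [B] was removed. *)
Lemma raise_lower_admissible s t :
  s + t = c.+1 -> admissible k l (raise s) (lower t).
Proof.
move=> est; split.
- by apply/subsetP => A; rewrite !inE => /orP[/(subsetP uA)|/andP[]//]; rewrite inE.
- by apply: subset_trans uB; apply: subsetDl.
move=> A B; rewrite [A \in _]inE => /orP[AF|].
  by rewrite inE => /andP[_ BF]; exact: cr.
rewrite inE => /andP[/eqP cardA bdA]; rewrite inE => /andP[nB BF].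
have cardB := card_ksubsets uB BF.
have [sDI cD _ [A1 [A1F cA1 trA1]]] := boundary_witness bdA.
set D := A :&: init n c.+1 in bdA sDI cD trA1.
have cA : c \notin A.
  apply: contraNN (init_notin c) => cA; apply: (subsetP sDI).
  by rewrite !inE cA ltnS leqnn.
have trA : A :&: init n c = D by rewrite /D traceS_out.
have DB : D :&: B = A1 :&: B :&: init n c by rewrite -trA1 setIAC.
have tr1 := trace_cross le_kl uA uB shA dA cr A1F.
apply: leq_trans (_ : 2 <= #|D :&: B|) _; last first.
  by apply: subset_leq_card; rewrite setSI // subsetIl.
have [cB|cB] := boolP (c \in B); last first.
  by have := tr1 _ BF; rewrite traceS_out ?DB // inE negb_and cB orbT.
rewrite DB leqNgt; apply/negP => lt2.
have := tight_pair A1F BF cA1 cB lt2; rewrite trA1 cD -est => /addnI cF.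
case/negP: nB; rewrite inE cardB eqxx traceS_in //=; apply: imset_f.
have BT : B :&: init n c.+1 \in traces BB c.+1 by apply/imsetP; exists B.
rewrite inE subsetIr cF eqxx -traceS_in // BT /=.
apply/negP => /imsetP[B2 B2F trB2].
by have := tr1 _ B2F; rewrite -setIA -trB2 setIA leqNgt lt2.
Qed.

Lemma card_raise s : s < k ->
  #|raise s| = #|AA| + #|boundary AA c s| * 'C(n - c.+1, k - s).
Proof.
move=> lt_sk; have bdP E : E \in boundary AA c s -> E \subset init n c.+1 /\ #|E| = s.
  rewrite inE => /and4P[sE /eqP cE _ _]; split=> //.
  by apply: subset_trans sE _; rewrite initS subsetUr.
have := card_trace bdP (ltnW lt_sk); rewrite card_ord card_init ?ltn_ord // => <-.
rewrite cardsU (_ : _ :&: _ = set0) ?cards0 ?subn0 //.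
apply/setP => A; rewrite !inE; apply/negP => /andP[AF /and5P[_ _ _ _]].
by case/negP; apply/imsetP; exists A.
Qed.

End Push.

Lemma card_lower n l (c : 'I_n) (BB : {set {set 'I_n}}) t :
  BB \subset ksubsets n l -> determined l BB c.+1 -> t < l ->
  #|BB| = #|lower l c BB t| + #|boundary BB c t| * 'C(n - c.+1, l - t.+1).
Proof.
move=> uB dB lt_tl.
pose GG := [set c |: F | F in boundary BB c t].
have GGP E : E \in GG -> E \subset init n c.+1 /\ #|E| = t.+1.
  case/imsetP=> F bdF ->; have [sF cF _ _] := boundary_witness bdF.
  rewrite initS setUS // cardsU1 cF.
  by have /negbTE -> : c \notin F by apply: contraNN (init_notin c); apply: (subsetP sF).
have cGG : #|GG| = #|boundary BB c t|.
  apply: card_in_imset => F G /boundary_witness[sF _ _ _] /boundary_witness[sG _ _ _].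
  move=> /(congr1 (fun E => E :\ c)); rewrite !setU1K //.
    by apply: contraNN (init_notin c); apply: (subsetP sG).
  by apply: contraNN (init_notin c); apply: (subsetP sF).
have := card_trace GGP lt_tl; rewrite card_ord card_init ?ltn_ord // cGG => <-.
rewrite -cardsUI /lower setDE; set RR := [set B | _].
have -> : BB :&: ~: RR :|: RR = BB.
  rewrite setUIl [~: RR :|: RR]setUC setUCr setIT; apply/setUidPl/subsetP => B.
  rewrite inE => /andP[/eqP cB /imsetP[F bdF trB]].
  have := bdF; rewrite inE => /and4P[_ _ /imsetP[B1 B1F trB1] _].
  by apply: (trace_full dB B1F) => //; rewrite trB -trB1.
by rewrite -setIA [~: RR :&: RR]setIC setICr setI0 cards0 addn0.
Qed.

(* The two inequalities say that neither exchanging [X] for [Y'] nor [Y] for [X']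
   increases the product of the sizes [a0 + X] and [b0 + Y]. *)
Lemma exchange_bound (a0 b0 X X' Y Y' K L W : nat) :
  0 < Y ->
  K.+1 * X' = (L.+1 + W) * X -> L.+1 * Y' = (K.+1 + W) * Y ->
  (a0 + X + X') * b0 <= (a0 + X) * (b0 + Y) ->
  (b0 + Y + Y') * a0 <= (a0 + X) * (b0 + Y) ->
  (a0 + X) * W <= X * (L.+1 + W).
Proof.
move=> Y_gt0 eX eY exA exB.
have le1 : (L.+1 + W) * X * b0 <= K.+1 * ((a0 + X) * Y).
  rewrite -eX -mulnA leq_mul2l /=; move: exA; rewrite mulnDl mulnDr leq_add2l //.
have le2 : (K.+1 + W) * Y * a0 <= L.+1 * (X * (b0 + Y)).
  by rewrite -eY -mulnA leq_mul2l /=; nia.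
(* [le1] eliminates [b0] from [le2], and [Y] cancels. *)
have le3 : (L.+1 + W) * ((K.+1 + W) * a0) <= L.+1 * (K.+1 * (a0 + X) + (L.+1 + W) * X).
  by rewrite -(leq_pmul2r Y_gt0); nia.
have : (K + L + W).+2 * ((a0 + X) * W) <= (K + L + W).+2 * (X * (L.+1 + W)) by nia.
by rewrite leq_pmul2l.
Qed.

Section OptimalBoundary.
Variables (n k l : nat) (c : 'I_n) (AA BB : {set {set 'I_n}}).
Hypothesis le_kl : k + l <= n.
Hypothesis opt : optimal k l AA BB.
Hypothesis B_gt0 : 0 < #|BB|.
Hypotheses (shA : shifted AA) (shB : shifted BB).
Hypotheses (dA : determined k AA c.+1) (dB : determined l BB c.+1).

Lemma boundary_lt (FF : {set {set 'I_n}}) u s :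
  FF \subset ksubsets n u -> boundary FF c s != set0 -> s < u.
Proof.
move=> uF /set0Pn[D /boundary_witness[_ cD _ [A [AF cA trA]]]].
rewrite -(card_ksubsets uF AF) -cD -trA (cardsD1 c A) cA.
rewrite add1n ltnS subset_leq_card // subsetD1 subsetIl.
by rewrite inE (negbTE (init_notin c)) andbF.
Qed.

(** Otherwise [lower] removes nothing while [raise] adds sets, the binomial coefficient being
    positive by [k - s <= n - c.+1], and the product grows. *)
Lemma boundary_partner s t : s + t = c.+1 -> k - s <= n - c.+1 ->
  boundary AA c s != set0 -> boundary BB c t != set0.
Proof.
have [[uA uB cr] opt2] := opt => est leN bA0; have lt_sk := boundary_lt uA bA0.
apply/negP => /eqP bB0.
have := opt2 _ _ (raise_lower_admissible le_kl uA shA dA uB cr est).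
have -> : lower l c BB t = BB.
  by rewrite /lower bB0 imset0; apply/setP => B; rewrite !inE andbF.
rewrite leq_pmul2r // card_raise // -[X in _ <= X]addn0 leq_add2l leqn0 muln_eq0.
by rewrite cards_eq0 (negbTE bA0) /= -leqn0 leqNgt bin_gt0 leN.
Qed.

(** This is [exchange_bound], with [X] and [X'] the numbers of sets lost by lowering and gained by
    raising [AA], and [Y], [Y'] likewise for [BB]. As [s + t = c + 1], both ratios of neighbouring
    binomial coefficients involve the same [W = n + 1 - k - l]. *)
Lemma boundary_bound s t : s + t = c.+1 -> k - s <= n - c.+1 ->
  boundary AA c s != set0 ->
  #|AA| * (n.+1 - k - l)
    <= #|boundary AA c s| * 'C(n - c.+1, k - s.+1) * (n.+1 - k - t).
Proof.
move=> est leN bA0; have bB0 := boundary_partner est leN bA0.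
have [[uA uB cr] opt2] := opt.
have lt_sk := boundary_lt uA bA0; have lt_tl := boundary_lt uB bB0.
have ets : t + s = c.+1 by rewrite addnC.
have := opt2 _ _ (raise_lower_admissible le_kl uA shA dA uB cr est).
have := opt2 _ _ (admissible_sym (raise_lower_admissible
  (etrans (f_equal (fun x => x <= n) (addnC l k)) le_kl) uB shB dB uA (cross_sym cr) ets)).
rewrite !card_raise // (card_lower uA dA lt_sk) (card_lower uB dB lt_tl).
set g := #|boundary AA c s|; set h := #|boundary BB c t|.
set a0 := #|lower k c AA s|; set b0 := #|lower l c BB t| => exB exA.
have lt_cn := ltn_ord c.
have -> : n.+1 - k - t = (l - t.+1).+1 + (n.+1 - k - l) by lia.
apply: (@exchange_bound _ b0 _ (g * 'C(n - c.+1, k - s))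
   (h * 'C(n - c.+1, l - t.+1)) (h * 'C(n - c.+1, l - t)) (k - s.+1)).
- rewrite muln_gt0 bin_gt0; apply/andP; split; last by lia.
  by rewrite lt0n cards_eq0.
- rewrite mulnCA [RHS]mulnCA; congr (_ * _).
  have -> : k - s = (k - s.+1).+1 by lia.
  by rewrite mul_bin_left; congr (_ * _); lia.
- rewrite mulnCA [RHS]mulnCA; congr (_ * _).
  have -> : l - t = (l - t.+1).+1 by lia.
  by rewrite mul_bin_left; congr (_ * _); lia.
- exact: exA.
- by rewrite mulnC.
Qed.

End OptimalBoundary.

(** * Upper shadow of the boundary *)

Definition upper_shadow (T : finType) (U : {set T}) (GG : {set {set T}}) s :=
  [set E : {set T} | [&& E \subset U, #|E| == s.+1 & [exists D in GG, D \subset E]]].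

(** Double counting of the inclusions [D \subset E]. *)
Lemma card_upper_shadow (T : finType) (U : {set T}) (GG : {set {set T}}) s :
  (forall D, D \in GG -> D \subset U /\ #|D| = s) ->
  #|GG| * (#|U| - s) <= #|upper_shadow U GG s| * s.+1.
Proof.
move=> GGP; set SS := upper_shadow U GG s.
apply: (@leq_trans (\sum_(D in GG) \sum_(E in SS | D \subset E) 1)).
  rewrite -sum_nat_const leq_sum // => D DG; have [sDU cD] := GGP D DG.
  have <- : #|U :\: D| = #|U| - s by rewrite cardsD (setIidPr sDU) cD.
  rewrite sum1_card.
  rewrite -(@card_in_imset _ _ (fun e => e |: D)); last first.
    move=> x y; rewrite !inE => /andP[xD _] /andP[yD _] /setP/(_ x).
    by rewrite !inE eqxx (negbTE xD) !orbF => /esym/eqP.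
  apply/subset_leq_card/subsetP => E /imsetP[e]; rewrite inE => /andP[eD eU] ->.
  rewrite unfold_in /= inE subsetUr subUset sub1set eU sDU cardsU1 eD cD eqxx /= andbT.
  by apply/existsP; exists D; rewrite DG subsetUr.
rewrite (exchange_big_dep (mem SS)) /=; last by move=> D E _ /andP[].
rewrite -sum_nat_const leq_sum // => E; rewrite inE => /and3P[_ /eqP cE _].
rewrite sum1_card -cE; apply: leq_trans (leq_imset_card (fun e => E :\ e) E).
apply/subset_leq_card/subsetP => D; rewrite unfold_in /= => /andP[DG /andP[_ sDE]].
have [_ cD] := GGP D DG; have /cards1P[e eE] : #|E :\: D| == 1.
  by rewrite cardsD (setIidPr sDE) cE cD subSnn.
apply/imsetP; exists e.
  by have : e \in E :\: D; [rewrite eE set11 | rewrite inE => /andP[]].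
by rewrite -eE setDDr setDv set0U (setIidPr sDE).
Qed.

Section BoundarySize.
Variables (n k : nat) (c : 'I_n) (AA : {set {set 'I_n}}) (s : nat).
Hypotheses (uA : AA \subset ksubsets n k) (shA : shifted AA).
Hypothesis dA : determined k AA c.+1.
Hypothesis bA0 : boundary AA c s != set0.

Lemma boundaryP D : D \in boundary AA c s -> D \subset init n c /\ #|D| = s.
Proof. by case/boundary_witness. Qed.

(** [boundary_up] puts [A] into [AA], and the sets removed by [lower] have exactly [s] points below
    [c]. *)
Lemma mem_lower (A D : {set 'I_n}) : #|A| = k -> D \in boundary AA c s ->
  D \subset A -> s < #|A :&: init n c| -> A \in lower k c AA s.
Proof.
move=> cA bD sDA lt_s; rewrite inE (boundary_up uA shA dA bD) // andbT.
rewrite inE cA eqxx /=; apply/negP => /imsetP[E bE trA].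
have [sE cE] := boundaryP bE; have [_ trE] := trace_of_traceS sE trA.
by rewrite trE cE ltnn in lt_s.
Qed.

Lemma shadow_sub :
  [set A : {set 'I_n} | (#|A| == k) &&
     (A :&: init n c \in upper_shadow (init n c) (boundary AA c s) s)]
  \subset lower k c AA s.
Proof.
apply/subsetP => A; rewrite inE => /andP[/eqP cA]; rewrite inE.
case/and3P=> _ /eqP cE /existsP[D /andP[bD sDE]].
by apply: (mem_lower cA bD); rewrite ?cE //; apply: subset_trans sDE (subsetIl _ _).
Qed.

Lemma card_shadow : s < k ->
  #|[set A : {set 'I_n} | (#|A| == k) &&
     (A :&: init n c \in upper_shadow (init n c) (boundary AA c s) s)]|
  = #|upper_shadow (init n c) (boundary AA c s) s| * 'C(n - c, k - s.+1).
Proof.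
move=> lt_sk; rewrite (card_trace (s := s.+1)) // ?card_ord ?card_init ?(ltnW (ltn_ord c)) //.
by move=> E; rewrite inE => /and3P[sE /eqP cE _].
Qed.

(** Two disjoint classes of members are counted: those whose trace is a boundary set plus [c], and
    those whose trace below [c] is in the upper shadow. *)
Lemma boundary_size :
  #|boundary AA c s| * (s.+1 * 'C(n - c.+1, k - s.+1) + (c - s) * 'C(n - c, k - s.+1))
    <= s.+1 * #|AA|.
Proof.
have lt_sk := boundary_lt uA bA0.
rewrite (card_lower uA dA lt_sk); have := subset_leq_card shadow_sub.
rewrite card_shadow //; have := card_upper_shadow boundaryP.
rewrite card_init ?(ltnW (ltn_ord c)) //.
set g := #|boundary _ _ _|; set d := #|upper_shadow _ _ _|; move=> le1 le2.
set P := 'C(n - c.+1, _); set Q := 'C(_, _) in le2 *.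
have : g * (c - s) * Q <= s.+1 * #|lower k c AA s|.
  apply: leq_trans (leq_mul le1 (leqnn _)) _.
  by rewrite mulnAC mulnC leq_mul2l le2 orbT.
by move: (c - s) #|lower k c AA s| => e a0; nia.
Qed.

Lemma boundary_size2 : s.+1 < c -> c <= k ->
  #|boundary AA c s| * (s.+1 * 'C(n - c.+1, k - s.+1) + (c - s) * 'C(n - c, k - s.+1))
    + s.+1 * 'C(n - c, k - c) <= s.+1 * #|AA|.
Proof.
move=> lt_sc le_ck; have lt_sk := boundary_lt uA bA0.
have cI : #|init n c| = c by rewrite card_init // ltnW.
rewrite (card_lower uA dA lt_sk).
set S2 := [set A : {set 'I_n} | (#|A| == k) && (A :&: init n c \in [set init n c])].
have cS2 : #|S2| = 'C(n - c, k - c).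
  rewrite (card_trace (s := c)) // ?card_ord ?cI ?cards1 ?mul1n //.
  by move=> E /set1P ->; rewrite cI.
have sS2 : S2 \subset lower k c AA s.
  apply/subsetP => A; rewrite inE => /andP[/eqP cA /set1P trA].
  have /set0Pn[D bD] := bA0; have [sD _] := boundaryP bD.
  apply: (mem_lower cA bD); last by rewrite trA cI ltnW.
  by apply: subset_trans sD _; rewrite -trA subsetIl.
have := shadow_sub; have := card_shadow lt_sk; set S1 := [set A | _] => cS1 sS1.
have : #|S1| + #|S2| <= #|lower k c AA s|.
  rewrite -cardsUI; have -> : S1 :&: S2 = set0.
    apply/setP => A; rewrite !inE; apply/negP.
    case/andP=> /andP[_ /and3P[_ /eqP cE _]] /andP[_ /eqP trA].
    by move: lt_sc; rewrite -cE trA cI ltnn.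
  by rewrite cards0 addn0 subset_leq_card // subUset sS1.
rewrite cS1 cS2; have := card_upper_shadow boundaryP; rewrite cI.
set g := #|boundary _ _ _|; set d := #|upper_shadow _ _ _|; move=> le1 le2.
set P := 'C(n - c.+1, _); set Q := 'C(_, k - s.+1) in le2 *.
set R := 'C(_, k - c) in le2 *.
have : g * (c - s) * Q <= s.+1 * (d * Q).
  by apply: leq_trans (leq_mul le1 (leqnn _)) _; rewrite mulnAC mulnC.
by move: (c - s) (d * Q) #|lower k c AA s| le2 => e dQ a0; nia.
Qed.

End BoundarySize.

(** * Levels at which the boundary can be nonempty *)

(** Here [a] is the size of a family, [g] the number of its boundary sets, and [C], [C1] are the
    binomial coefficients of [boundary_size], whose [s.+1] is the present [s]. Both [g] and [C]
    cancel between the upper and the lower bound on [a]. *)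
Lemma shadow_ratio (a g C C1 p W d e s N1 : nat) :
  0 < g -> 0 < C -> p = W + d ->
  a * W <= g * C * p -> g * (s * C + e * C1) <= s * a ->
  p.+1 * C1 = N1 * C ->
  W * (e * N1) <= s * (p.+1 * d).
Proof.
move=> g0 C0 ep le1 le2 eC.
have le3 : W * (s * C + e * C1) <= s * (C * p) by rewrite -(leq_pmul2l g0); nia.
have le4 : C * (W * (s * p.+1 + e * N1)) <= C * (s * p * p.+1).
  have := leq_mul (leqnn p.+1) le3.
  have -> : p.+1 * (W * (s * C + e * C1)) = W * (s * C * p.+1 + e * (p.+1 * C1)) by ring.
  by rewrite eC; lia.
by move: le4; rewrite leq_pmul2l // ep; lia.
Qed.

(** The case [s = t = 3], [c = 5]: 4 is [s + 1], 2 is [c - s], and 10 is ['C(5, 3)]. Bounding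
    [g * C2] by [10 * C2] allows [g] to be cancelled again. *)
Lemma shadow_ratio2 (a g C C1 C2 p W d K N1 : nat) :
  0 < g <= 10 -> 0 < C -> p = W + d ->
  a * W <= g * C * p -> g * (4 * C + 2 * C1) + 4 * C2 <= 4 * a ->
  p.+1 * C1 = N1 * C -> p.+2 * C2 = K * C1 ->
  W * (N1 * (5 * p.+2 + K)) <= 10 * (d * p.+1 * p.+2).
Proof.
move=> /andP[g0 g10] C0 ep le1 le2 eC eC2.
have le3 : W * (10 * C + 5 * C1 + C2) <= 10 * (C * p).
  have lt3 : g * (40 * C + 20 * C1 + 4 * C2) <= 40 * a.
    have := leq_mul g10 (leqnn (4 * C2)); lia.
  have : W * (g * (40 * C + 20 * C1 + 4 * C2)) <= 40 * (g * C * p).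
    by apply: leq_trans (leq_mul (leqnn W) lt3) _; lia.
  by move=> le4; rewrite -(@leq_pmul2l (4 * g)) ?muln_gt0 //; lia.
have le4 : C * (W * (10 * (p.+1 * p.+2) + 5 * N1 * p.+2 + K * N1)) <= C * (10 * p * (p.+1 * p.+2)).
  have := leq_mul (leqnn (p.+1 * p.+2)) le3.
  have -> : p.+1 * p.+2 * (W * (10 * C + 5 * C1 + C2))
    = W * (10 * C * (p.+1 * p.+2) + 5 * p.+2 * (p.+1 * C1) + p.+1 * (p.+2 * C2)) by ring.
  have -> : p.+1 * (p.+2 * C2) = K * (p.+1 * C1) by rewrite eC2; ring.
  by rewrite eC; lia.
by move: le4; rewrite leq_pmul2l // ep; lia.
Qed.

Lemma card_boundary n (FF : {set {set 'I_n}}) (c : 'I_n) s :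
  #|boundary FF c s| <= 'C(c, s).
Proof.
rewrite -[X in 'C(X, _)](@card_init n) ?(ltnW (ltn_ord c)) // -cards_draws.
apply/subset_leq_card/subsetP => D /boundary_witness[sD cD _ _].
by rewrite inE sD cD eqxx.
Qed.

Section BoundaryLevels.
Variables (n k l : nat) (c : 'I_n) (AA BB : {set {set 'I_n}}).
Hypotheses (hk : 338 * k <= 100 * n) (hl : 338 * l <= 100 * n).
Hypothesis opt : optimal k l AA BB.
Hypothesis B_gt0 : 0 < #|BB|.
Hypotheses (shA : shifted AA) (shB : shifted BB).
Hypotheses (dA : determined k AA c.+1) (dB : determined l BB c.+1).
Variables (s t : nat).
Hypotheses (est : s + t = c.+1) (leN : k - s <= n - c.+1).
Hypothesis bA0 : boundary AA c s != set0.

Let le_kl : k + l <= n. Proof. lia. Qed.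

Let bB0 : boundary BB c t != set0.
Proof. exact (boundary_partner le_kl opt B_gt0 shA dA est leN bA0). Qed.

Lemma boundary_le (FF : {set {set 'I_n}}) u : boundary FF c u != set0 -> u <= c.
Proof.
case/set0Pn=> D /boundary_witness[sD <- _ _].
by have := subset_leq_card sD; rewrite card_init // ltnW.
Qed.

Let bounds : [/\ s < k, t < l, 0 < s & 0 < t].
Proof.
have [[uA uB _] _] := opt.
have := boundary_lt uA bA0; have := boundary_lt uB bB0.
have := boundary_le bA0; have := boundary_le bB0.
by move=> *; split; lia.
Qed.

Lemma boundary_ineq :
  (n.+1 - k - l) * (t.-1 * (n - c)) <= s.+1 * ((n.+2 - k - t) * (l - t)).
Proof.
have [[uA uB _] _] := opt; have [lt_sk lt_tl s0 t0] := bounds.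
have lt_cn := ltn_ord c.
have le1 := boundary_bound le_kl opt B_gt0 shA shB dA dB est leN bA0.
have le2 := boundary_size uA shA dA bA0.
have -> : n.+2 - k - t = (n.+1 - k - t).+1 by lia.
have -> : t.-1 = c - s by lia.
apply: shadow_ratio le1 le2 _; first by rewrite lt0n cards_eq0.
- by rewrite bin_gt0; lia.
- by lia.
- have -> : n - c.+1 = (n - c).-1 by lia.
  by rewrite mul_bin_down; congr (_ * _); lia.
Qed.

Lemma boundary_not33 : (s, t) != (3, 3).
Proof.
apply/negP => /eqP[s3 t3].
have [[uA uB _] _] := opt; have [lt_sk lt_tl s0 t0] := bounds.
have lt_cn := ltn_ord c; have c5 : c = 5 :> nat by lia.
have le1 := boundary_bound le_kl opt B_gt0 shA shB dA dB est leN bA0.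
have k4 : 3 < k by rewrite -s3.
have l4 : 3 < l by rewrite -t3.
have := level_4_4 hk hl k4 l4; apply/negP; rewrite -leqNgt.
(* For [k = 4] no member contains five points; as [k - 4 = 0], the inequality from one shadow level,
   times [5 * (n - 4)], suffices. *)
have [k5|k5] := leqP c k; last first.
  have ek : k = 4 by lia.
  have := boundary_ineq; rewrite s3 t3 c5 ek subnn addn0.
  have -> : n.+2 - 4 - 3 = n - 4 - 1 by lia.
  move: (n.+1 - 4 - l) (n - 4 - 1) (n - 4) (n - 5) (l - 3) => W p q r v /= le2.
  have := leq_mul (leqnn (5 * q)) le2; lia.
have lt_sc : s.+1 < c by rewrite s3 c5.
have le2 := boundary_size2 uA shA dA bA0 lt_sc k5.
have g10 : 0 < #|boundary AA c s| <= 10.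
  rewrite lt0n cards_eq0 bA0; apply: leq_trans (card_boundary _ _ _) _.
  by rewrite s3 c5.
have -> : n - 5 = n - c by rewrite c5.
have -> : n - k = (n.+1 - k - t).+2 by lia.
have -> : (n.+1 - k - t).+2 - 1 = (n.+1 - k - t).+1 by lia.
rewrite s3 in le1 le2 g10; rewrite t3 in le1 *; rewrite c5 in le1 le2 *.
have eN : n - 5.+1 = (n - 5).-1 by lia.
apply: (shadow_ratio2 (C2 := 'C(n - 5, k - 5)) g10 _ _ le1 le2); rewrite ?eN.
- by rewrite bin_gt0; lia.
- by lia.
- by rewrite mul_bin_down; congr (_ * _); lia.
- have -> : k - 4 = (k - 5).+1 by lia.
  by rewrite mul_bin_left; congr (_ * _); lia.
Qed.

(** [levels_large] is applied with the roles of the families exchanged, because [boundary_ineq] has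
    the factor [t.-1]. *)
Lemma boundary_small : s <= t -> (s, t) \in [:: (1, 1); (1, 2); (2, 2)].
Proof.
have [lt_sk lt_tl s0 t0] := bounds => le_st; have n33 := boundary_not33.
have := @levels_large n l k t s hl hk s0 le_st lt_tl lt_sk.
have -> : n.+1 - l - k = n.+1 - k - l by lia.
have -> : n.+1 - t - s = n - c by lia.
move/(_ boundary_ineq).
rewrite !inE !xpair_eqE; case/or4P => /andP[/eqP et /eqP es]; rewrite es et //.
by rewrite et es in n33.
Qed.

End BoundaryLevels.

(** * Optimal shifted pairs *)

(** Let [A] in and [B] outside [FF] agree below [c]. If [A] lacked [c], then [B] would contain it,
    and shifting a point of [A] above [c] to [c] would give the trace of [B]. So [c] is in [A] but
    not in [B], and the common trace is a boundary set; the other points of [B] lie above [c],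
    whence the inequality. *)
Lemma boundary_of_not_determined n k (c : 'I_n) (FF : {set {set 'I_n}}) :
  FF \subset ksubsets n k -> shifted FF -> determined k FF c.+1 ->
  ~~ determined k FF c ->
  exists2 s, boundary FF c s != set0 & k - s <= n - c.+1.
Proof.
move=> uF shF dF; rewrite negb_forall_in => /exists_inP[A AF].
rewrite negb_forall => /existsP[B]; rewrite negb_imply.
case/andP=> /andP[/eqP cB /eqP trAB] nBF; have cA := card_ksubsets uF AF.
have cAx : c \in A.
  apply: contraNT nBF => cA'; have [cB'|cB'] := boolP (c \in B); last first.
    by apply: (trace_full dF AF cB); rewrite !traceS_out.
  have : #|A :\: init n c| != 0.
    have -> : #|A :\: init n c| = #|B :\: init n c| by rewrite !cardsD trAB cA cB.
    by rewrite cards_eq0; apply/set0Pn; exists c; rewrite inE init_notin.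
  rewrite cards_eq0 => /set0Pn[y]; rewrite !inE -leqNgt => /andP[le_cy yA].
  have lt_cy : c < y.
    by rewrite ltn_neqAle le_cy andbT; apply: contraNneq cA' => /val_inj ->.
  apply: (trace_full dF (shF _ _ _ lt_cy AF yA cA') cB).
  rewrite traceS_in ?setU11 // [RHS]traceS_in // -trAB; congr (_ |: _).
  apply/setP => x; rewrite !inE; case: (eqVneq x y) => [->|_] /=.
    by rewrite [y < c]ltnNge le_cy !andbF.
  by case: (eqVneq x c) => [->|//]; rewrite ltnn !andbF.
have cBx : c \notin B.
  by apply: contra nBF => cB'; apply: (trace_full dF AF cB); rewrite !traceS_in // trAB.
exists #|A :&: init n c|.
  apply/set0Pn; exists (A :&: init n c); rewrite inE subsetIr eqxx /=.
  rewrite -traceS_in //; apply/andP; split; first by apply/imsetP; exists A.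
  apply: contra nBF => /imsetP[A2 A2F trA2].
  by apply: (trace_full dF A2F cB); rewrite -trA2 traceS_out.
have -> : n - c.+1 = #|~: init n c.+1|.
  by rewrite -{1}(card_ord n) -(cardsC (init n c.+1)) card_init ?ltn_ord ?addKn.
rewrite trAB -cB -cardsD; apply/subset_leq_card/subsetP => x.
rewrite !inE -!leqNgt => /andP[le_cx xB].
by rewrite ltn_neqAle le_cx andbT; apply: contraNneq cBx => /val_inj ->.
Qed.

(** * Stars and binomial ratios *)

Definition star n k (T : {set 'I_n}) := [set A in ksubsets n k | T \subset A].

Lemma mem_star n k (T A : {set 'I_n}) :
  (A \in star k T) = (#|A| == k) && (T \subset A).
Proof. by rewrite !inE. Qed.

Lemma card_star n k (T : {set 'I_n}) : #|T| <= k ->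
  #|star k T| = 'C(n - #|T|, k - #|T|).
Proof.
move=> le_Tk; have : forall E : {set 'I_n}, E \in [set T] -> E \subset T /\ #|E| = #|T|.
  by move=> E /set1P ->.
move/card_trace => /(_ _ le_Tk); rewrite card_ord cards1 mul1n => <-.
apply: eq_card => A; rewrite mem_star !inE; congr (_ && _).
by apply/idP/eqP => /setIidPr.
Qed.

Lemma star_admissible n k l (T : {set 'I_n}) : #|T| = 2 ->
  admissible k l (star k T) (star l T).
Proof.
move=> cT; split; try by apply/subsetP => A; rewrite inE => /andP[].
move=> A B; rewrite !mem_star => /andP[_ sTA] /andP[_ sTB].
by rewrite -cT subset_leq_card // subsetI sTA.
Qed.

Lemma card_meet n k m j : m <= n -> j <= k ->
  #|[set A : {set 'I_n} | (#|A| == k) && (#|A :&: init n m| == j)]|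
    = 'C(m, j) * 'C(n - m, k - j).
Proof.
move=> le_mn le_jk; pose GG := [set E : {set 'I_n} | E \subset init n m & #|E| == j].
have GGP E : E \in GG -> E \subset init n m /\ #|E| = j.
  by rewrite inE => /andP[sE /eqP].
have := card_trace GGP le_jk; rewrite cards_draws card_ord card_init // => <-.
by apply: eq_card => A; rewrite !inE subsetIr.
Qed.

(** The two trace points are shifted down to the two smallest points; nothing changes from [m]
    on. *)
Lemma low_pair n k m (FF : {set {set 'I_n}}) (A : {set 'I_n}) :
  FF \subset ksubsets n k -> shifted FF -> 1 < m <= n ->
  A \in FF -> #|A :&: init n m| = 2 ->
  exists2 A' : {set 'I_n}, A' \in FF & A' :&: init n m = init n 2.
Proof.
move=> uF shF /andP[m2 le_mn] AF trA.
have s2m : init n 2 \subset init n m by apply/subsetP => x; rewrite !inE => /leq_trans; apply.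
have dI : init n 2 :&: (A :\: init n m) = set0.
  apply/setP => x; rewrite !inE; case: (ltnP x 2) => //= x2.
  by rewrite (leq_trans x2 m2).
exists (init n 2 :|: A :\: init n m); last first.
  by rewrite setIUl setDE -setIA [~: _ :&: _]setIC setICr setI0 setU0; apply/setIidPl.
apply: (shifted_below shF AF).
  rewrite cardsU dI cards0 subn0 card_init ?(leq_trans m2) // -trA.
  by rewrite cardsID.
move=> x y; rewrite !inE => /andP[xA x2] /andP[].
rewrite negb_or => /andP[y2 ym] yA.
have {}x2 : x < 2 by case/orP: x2 => // /andP[_]; rewrite (negbTE xA).
by apply: leq_trans x2 _; rewrite leqNgt.
Qed.

(** This and the next three lemmas compare the counts for traces on three or four points with the
    star size ['C(n - 2, u - 2)]. *)
Lemma bin3_ratio n u : 2 < u -> u <= n ->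
  (n - 2) * 'C(n - 3, u - 3) = (u - 2) * 'C(n - 2, u - 2).
Proof.
move=> u3 le_un; have -> : u - 2 = (u - 3).+1 by lia.
by rewrite -mul_bin_diag; congr (_ * 'C(_, _)); lia.
Qed.

Lemma bin4_ratio n u : 2 < u -> u <= n ->
  (n - 2) * (n - 3) * 'C(n - 4, u - 3) = (u - 2) * (n - u) * 'C(n - 2, u - 2).
Proof.
move=> u3 le_un; have -> : n - 4 = (n - 3).-1 by lia.
rewrite -mulnA mul_bin_down mulnCA bin3_ratio // mulnCA mulnA; congr (_ * _).
by congr (_ * _); lia.
Qed.

Lemma bin4_ratio' n u : 3 < u -> u <= n ->
  (n - 2) * (n - 3) * 'C(n - 4, u - 4) = (u - 2) * (u - 3) * 'C(n - 2, u - 2).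
Proof.
move=> u4 le_un; have -> : n - 4 = (n - 3).-1 by lia.
have := @mul_bin_diag (n - 3) (u - 4); have -> : (u - 4).+1 = u - 3 by lia.
by rewrite -mulnA => ->; rewrite mulnCA bin3_ratio ?(ltnW u4) // mulnCA mulnA.
Qed.

Lemma binD_ratio n u : 1 < u -> u <= n ->
  (n - 2) * 'C(n - 3, u - 2) = (n - u) * 'C(n - 2, u - 2).
Proof.
move=> u2 le_un; have -> : n - 3 = (n - 2).-1 by lia.
by rewrite mul_bin_down; congr (_ * _); lia.
Qed.

Lemma heavy4_lt n (FF : {set {set 'I_n}}) u : 338 * u <= 100 * n -> 2 < u ->
  FF \subset ksubsets n u ->
  (forall A, A \in FF -> 2 < #|A :&: init n 4|) -> #|FF| < 'C(n - 2, u - 2).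
Proof.
move=> hu u3 uF FF3.
set S3 := [set A : {set 'I_n} | (#|A| == u) && (#|A :&: init n 4| == 3)].
set S4 := [set A : {set 'I_n} | (#|A| == u) && (#|A :&: init n 4| == 4)].
have n4 : 4 <= n by lia.
have cS3 : #|S3| = 4 * 'C(n - 4, u - 3) by rewrite card_meet.
have cS4 : (n - 2) * (n - 3) * #|S4| = (u - 2) * (u - 3) * 'C(n - 2, u - 2).
  have [u4|u4] := leqP 4 u; first by rewrite card_meet // mul1n bin4_ratio' //; lia.
  have -> : u - 3 = 0 by lia.
  rewrite muln0 mul0n; apply/eqP; rewrite muln_eq0 cards_eq0; apply/orP; right.
  apply/eqP/setP => A; rewrite !inE; apply/negP => /andP[/eqP cA /eqP c4].
  by have := subset_leq_card (subsetIl A (init n 4)); rewrite cA c4 leqNgt u4.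
have le_FF : #|FF| <= #|S3| + #|S4|.
  rewrite -cardsUI; apply: leq_trans (leq_addr _ _); apply/subset_leq_card/subsetP => A AF.
  rewrite !inE (card_ksubsets uF AF) eqxx /=.
  have := FF3 A AF; have := subset_leq_card (subsetIr A (init n 4)).
  by rewrite card_init //; case: (#|_|) => [|[|[|[|[|[|]]]]]].
have le_un : u <= n by lia.
have R_gt0 : 0 < 'C(n - 2, u - 2) by rewrite bin_gt0; lia.
rewrite -(@ltn_pmul2l ((n - 2) * (n - 3))); last by rewrite muln_gt0; apply/andP; split; lia.
apply: leq_ltn_trans (leq_mul (leqnn _) le_FF) _.
rewrite mulnDr cS4 cS3 mulnCA bin4_ratio // mulnA -mulnDl ltn_pmul2r //.
(* Writing [u = a + 3] and [n = 3 * a + 7 + b] turns the truncated differences into sums; the two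
   sides then differ by a polynomial with nonnegative coefficients. *)
have [a ea] : exists a, u = a + 3 by exists (u - 3); lia.
have [b eb] : exists b, n = 3 * a + 7 + b by exists (n - 7 - 3 * a); lia.
have -> : u - 2 = a + 1 by lia.
have -> : u - 3 = a by lia.
have -> : n - u = 2 * a + 4 + b by lia.
have -> : n - 2 = 3 * a + 5 + b by lia.
have -> : n - 3 = 3 * a + 4 + b by lia.
by lia.
Qed.

Section ShiftedOptimal.
Variables (n k l : nat) (AA BB : {set {set 'I_n}}).
Hypotheses (hk : 338 * k <= 100 * n) (hl : 338 * l <= 100 * n).
Hypotheses (k2 : 1 < k) (l2 : 1 < l).
Hypothesis opt : optimal k l AA BB.
Hypotheses (shA : shifted AA) (shB : shifted BB).

Let P := 'C(n - 2, k - 2).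
Let Q := 'C(n - 2, l - 2).

(** The stars over the two smallest points form an admissible pair with product [P * Q]. *)
Lemma opt_gt0 : [/\ 0 < P * Q, P * Q <= #|AA| * #|BB|, 0 < #|AA| & 0 < #|BB|].
Proof.
have n2 : 1 < n by lia.
have PQ0 : 0 < P * Q by rewrite muln_gt0 !bin_gt0; apply/andP; split; lia.
have c2 : #|init n 2| = 2 by rewrite card_init.
have := opt.2 _ _ (star_admissible k l c2).
rewrite !card_star c2 // -/P -/Q => le_PQ.
by have := leq_trans PQ0 le_PQ; rewrite muln_gt0 => /andP[].
Qed.


(** The boundary set is [init n 2], which is therefore no trace of [AA]; by [low_pair] every member
    of [AA] contains [init n 3]. Members of [BB] have at least two points there, and the resulting
    bounds have a product below [P * Q]. *)
Lemma level3_false (c : 'I_n) : c = 2 :> nat ->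
  determined k AA c.+1 -> boundary AA c 2 != set0 -> False.
Proof.
move=> c2 dA bA0; have [PQ0 le_PQ A0 B0] := opt_gt0.
have [[uA uB cr] _] := opt; have lt_2k := boundary_lt uA bA0.
have le_kl : k + l <= n by lia.
have [n3 le_ln le_kn] : [/\ 3 <= n, l <= n & k <= n] by split; lia.
have tr A B := @trace_cross n k l c.+1 AA BB A B le_kl uA uB shA dA cr.
have cI3 : #|init n 3| = 3 by rewrite card_init.
have ntr : init n 2 \notin traces AA c.+1.
  have /set0Pn[D /boundary_witness[sD cD nt _]] := bA0.
  suff <- : D = init n 2 by [].
  apply/eqP; rewrite eqEcard card_init ?(ltnW n3) // cD leqnn andbT.
  by move: sD; rewrite c2.
have /card_gt0P[B BF] := B0; have /card_gt0P[A AF] := A0.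
have leA : #|AA| <= 'C(n - 3, k - 3).
  rewrite -cI3 -card_star ?cI3 //; apply/subset_leq_card/subsetP => A1 A1F.
  rewrite mem_star (card_ksubsets uA A1F) eqxx /=; apply/setIidPr/eqP.
  rewrite setIC -[_ :&: _]setIC eqEcard subsetIr cI3 /=.
  have le2 : 2 <= #|A1 :&: init n 3|.
    apply: leq_trans (tr _ _ A1F BF) _; rewrite c2.
    by rewrite subset_leq_card // setSI // subsetIl.
  rewrite ltn_neqAle le2 andbT; apply/negP => /eqP e2.
  have m3 : 1 < 3 <= n by [].
  have [A' A'F trA'] := low_pair uA shA m3 A1F (esym e2).
  by case/negP: ntr; rewrite -trA' c2; apply/imsetP; exists A'.
set S2 := [set B : {set 'I_n} | (#|B| == l) && (#|B :&: init n 3| == 2)].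
set S3 := [set B : {set 'I_n} | (#|B| == l) && (#|B :&: init n 3| == 3)].
have cS2 : #|S2| = 3 * 'C(n - 3, l - 2) by rewrite card_meet.
have cS3 : (n - 2) * #|S3| = (l - 2) * Q.
  have [l3|l3] := leqP 3 l; first by rewrite card_meet // mul1n bin3_ratio.
  have -> : l - 2 = 0 by lia.
  rewrite mul0n; apply/eqP; rewrite muln_eq0 cards_eq0; apply/orP; right.
  apply/eqP/setP => B1; rewrite !inE; apply/negP => /andP[/eqP cB /eqP c3].
  by have := subset_leq_card (subsetIl B1 (init n 3)); rewrite cB c3 leqNgt l3.
have leB : #|BB| <= #|S2| + #|S3|.
  rewrite -cardsUI; apply: leq_trans (leq_addr _ _); apply/subset_leq_card/subsetP => B1 B1F.
  rewrite !inE (card_ksubsets uB B1F) eqxx /=.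
  have : 2 <= #|B1 :&: init n 3|.
    apply: leq_trans (tr _ _ AF B1F) _; rewrite c2.
    by rewrite subset_leq_card // setSI // subsetIr.
  have := subset_leq_card (subsetIr B1 (init n 3)).
  by rewrite cI3; case: (#|_|) => [|[|[|[|]]]].
have hA : (n - 2) * #|AA| <= (k - 2) * P.
  by rewrite -bin3_ratio // leq_mul2l leA orbT.
have hB : (n - 2) * #|BB| <= (3 * (n - l) + (l - 2)) * Q.
  apply: leq_trans (leq_mul (leqnn _) leB) _.
  by rewrite mulnDr cS3 cS2 mulnCA binD_ratio // mulnA -mulnDl.
have := leq_mul hA hB; apply/negP; rewrite -ltnNge.
apply: (@leq_trans ((n - 2) * (n - 2) * (P * Q))).
  rewrite mulnACA [X in _ < X]mulnC -[X in _ < X]mulnC ltn_pmul2r //.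
  (* What remains after this is [3 * (k - 2) < n - 2]. *)
  have : (k - 2) * (3 * (n - l) + (l - 2)) <= (k - 2) * (3 * (n - 2)).
    by rewrite leq_mul2l; lia.
  move/leq_ltn_trans; apply; rewrite mulnCA mulnA ltn_pmul2r; lia.
by rewrite [X in _ <= X]mulnACA leq_mul2l le_PQ orbT.
Qed.

(** If some member has only two points in [init n 4], then [init n 2] is a trace and [AA] contains
    the whole star over it, so [P <= #|AA|]. This contradicts [boundary_bound] by [level_star]. *)
Lemma level4_heavy (c : 'I_n) : c = 3 :> nat ->
  determined k AA c.+1 -> determined l BB c.+1 -> boundary AA c 2 != set0 ->
  forall A, A \in AA -> 2 < #|A :&: init n 4|.
Proof.
move=> c3 dA dB bA0 A AF; have [PQ0 le_PQ A0 B0] := opt_gt0.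
have [[uA uB cr] _] := opt; have lt_2k := boundary_lt uA bA0.
have le_kl : k + l <= n by lia.
have [n4 le_kn] : 4 <= n /\ k <= n by split; lia.
have /card_gt0P[B BF] := B0.
have le2 : 2 <= #|A :&: init n 4|.
  apply: leq_trans (trace_cross le_kl uA uB shA dA cr AF BF) _; rewrite c3.
  by rewrite subset_leq_card // setSI // subsetIl.
rewrite ltn_neqAle le2 andbT; apply/negP => /eqP e2.
have m4 : 1 < 4 <= n by [].
have [A' A'F trA'] := low_pair uA shA m4 AF (esym e2).
have cI2 : #|init n 2| = 2 by rewrite card_init // (leq_trans _ n4).
have leA : P <= #|AA|.
  have <- : #|star k (init n 2)| = P by rewrite card_star cI2.
  apply/subset_leq_card/subsetP => A1.
  rewrite mem_star => /andP[/eqP cA1 sA1]; apply: (trace_up uA shA dA A'F cA1).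
  by rewrite c3 trA'.
(* Of the three pairs in [init n 3], [init n 2] is a trace and hence not a boundary set. *)
have g2 : #|boundary AA c 2| <= 2.
  have : boundary AA c 2 \subset
      [set D : {set 'I_n} | D \subset init n 3 & #|D| == 2] :\ init n 2.
    apply/subsetP => D /boundary_witness[sD cD nt _].
    apply/setD1P; split; last by rewrite inE -c3 sD cD eqxx.
    apply/eqP => eD; case/negP: nt; rewrite eD.
    by apply/imsetP; exists A' => //; rewrite c3.
  move/subset_leq_card => /leq_trans; apply.
  have := cardsD1 (init n 2) [set D : {set 'I_n} | D \subset init n 3 & #|D| == 2].
  rewrite cards_draws card_init ?(ltnW n4) // inE cI2 eqxx andbT.
  have -> : init n 2 \subset init n 3 by apply/subsetP => x; rewrite !inE => /ltnW.
  by rewrite add1n => -[<-].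
have est : 2 + 2 = c.+1 by rewrite c3.
have leN : k - 2 <= n - c.+1 by rewrite c3; lia.
have := boundary_bound le_kl opt B0 shA shB dA dB est leN bA0.
rewrite c3; have -> : n.+1 - k - 2 = n - k - 1 by lia.
apply/negP; rewrite -ltnNge.
apply: leq_trans (_ : P * (n.+1 - k - l) <= _); last by rewrite leq_mul2r leA orbT.
apply: leq_ltn_trans (_ : 2 * 'C(n - 4, k - 3) * (n - k - 1) < _).
  by rewrite !leq_mul2r g2 !orbT.
have n23 : 0 < (n - 2) * (n - 3) by rewrite muln_gt0; apply/andP; split; lia.
rewrite -(ltn_pmul2l n23).
have -> : (n - 2) * (n - 3) * (2 * 'C(n - 4, k - 3) * (n - k - 1))
  = P * (2 * ((k - 2) * (n - k) * (n - k - 1))).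
  have := bin4_ratio lt_2k le_kn; rewrite -/P => e.
  have -> : (n - 2) * (n - 3) * (2 * 'C(n - 4, k - 3) * (n - k - 1))
     = 2 * ((n - 2) * (n - 3) * 'C(n - 4, k - 3)) * (n - k - 1) by ring.
  by rewrite e; ring.
rewrite [X in _ < X]mulnCA ltn_pmul2l; first exact: level_star.
by move: PQ0; rewrite muln_gt0 => /andP[].
Qed.

End ShiftedOptimal.

Lemma star_of_sub n k l (AA BB : {set {set 'I_n}}) (T : {set 'I_n}) :
  #|T| = 2 -> 1 < k -> 1 < l -> AA \subset star k T -> BB \subset star l T ->
  0 < 'C(n - 2, k - 2) * 'C(n - 2, l - 2) <= #|AA| * #|BB| ->
  AA = star k T /\ BB = star l T.
Proof.
move=> cT k2 l2 sA sB /andP[PQ0 le_PQ].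
have leA := subset_leq_card sA; have leB := subset_leq_card sB.
have cA : #|star k T| = 'C(n - 2, k - 2) by rewrite card_star cT.
have cB : #|star l T| = 'C(n - 2, l - 2) by rewrite card_star cT.
split; apply/eqP; rewrite eqEcard ?sA ?sB /= ?cA ?cB.
- have Q0 : 0 < 'C(n - 2, l - 2) by move: PQ0; rewrite muln_gt0 => /andP[].
  rewrite -(leq_pmul2r Q0); apply: leq_trans le_PQ _.
  by rewrite leq_mul2l -cB leB orbT.
- have P0 : 0 < 'C(n - 2, k - 2) by move: PQ0; rewrite muln_gt0 => /andP[].
  rewrite -(leq_pmul2l P0); apply: leq_trans le_PQ _.
  by rewrite leq_mul2r -cA leA orbT.
Qed.

Lemma shifted_optimal_star n k l (AA BB : {set {set 'I_n}}) :
  338 * k <= 100 * n -> 338 * l <= 100 * n -> 1 < k -> 1 < l ->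
  optimal k l AA BB -> shifted AA -> shifted BB ->
  exists2 T : {set 'I_n}, #|T| = 2 & AA = star k T /\ BB = star l T.
Proof.
move=> hk hl k2 l2 opt shA shB; have [PQ0 le_PQ A0 B0] := opt_gt0 hk hl k2 l2 opt.
have optS := optimal_sym opt.
have [[uA uB cr] _] := opt; have le_kl : k + l <= n by lia.
have ex_m : exists m, determined k AA m && determined l BB m.
  by exists n; rewrite !determined_full.
case: (ex_minnP ex_m) => m /andP[dA dB] min_m.
have le_mn : m <= n by apply: min_m; rewrite !determined_full.
have tr A B := @trace_cross n k l m AA BB A B le_kl uA uB shA dA cr.
have /card_gt0P[A AF] := A0; have /card_gt0P[B BF] := B0.
have m2 : 2 <= m.
  rewrite -(card_init le_mn); apply: leq_trans (tr _ _ AF BF) _.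
  by rewrite subset_leq_card ?subsetIr.
have [le_m2|lt_2m] := leqP m 2.
  have em : m = 2 by apply/eqP; rewrite eqn_leq le_m2.
  have n2 : 2 <= n by rewrite -em.
  have trI A1 B1 : A1 \in AA -> B1 \in BB -> init n 2 \subset A1 :&: B1.
    move=> A1F B1F; apply/setIidPr/eqP; rewrite eqEcard subsetIr card_init //.
    by have := tr _ _ A1F B1F; rewrite em.
  exists (init n 2); first by rewrite card_init.
  apply: star_of_sub => //; rewrite ?card_init ?PQ0 //.
    apply/subsetP => A1 A1F; rewrite mem_star (card_ksubsets uA A1F) eqxx /=.
    exact: subset_trans (trI _ _ A1F BF) (subsetIl _ _).
  apply/subsetP => B1 B1F; rewrite mem_star (card_ksubsets uB B1F) eqxx /=.
  exact: subset_trans (trI _ _ AF B1F) (subsetIr _ _).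
exfalso; have [c em] : exists c : 'I_n, m = c.+1.
  have lt_cn : m.-1 < n by lia.
  by exists (Ordinal lt_cn); rewrite /=; lia.
rewrite em in dA dB; clear tr.
have c_gt1 : 1 < c by lia.
have : ~~ (determined k AA c && determined l BB c).
  by apply/negP => /min_m; rewrite em ltnn.
(* Since [c > 1] excludes levels [(1, 1)], either one level is 1 and the other 2, with [c = 2], or
   both are 2, with [c = 3]. *)
have symm s t : s + t = c.+1 -> boundary AA c s != set0 -> boundary BB c t != set0 ->
    [|| [&& c == 2 :> nat & boundary AA c 2 != set0],
        [&& c == 2 :> nat & boundary BB c 2 != set0] |
        [&& c == 3 :> nat, boundary AA c 2 != set0 & boundary BB c 2 != set0]].
  move=> est bA0 bB0.
  have ets : t + s = c.+1 by rewrite addnC.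
  have lt_sk := boundary_lt uA bA0; have lt_tl := boundary_lt uB bB0.
  have leN : k - s <= n - c.+1 by lia.
  have leN' : l - t <= n - c.+1 by lia.
  case: (leqP s t) => [le_st|/ltnW le_ts].
    have := boundary_small hk hl opt B0 shA shB dA dB est leN bA0 le_st.
    rewrite !inE !xpair_eqE => /or3P[] /andP[/eqP es /eqP et]; move: est c_gt1 bA0 bB0;
      by rewrite es et => -[<-] // _ bA0 bB0; rewrite ?bA0 ?bB0 ?orbT.
  have := boundary_small hl hk optS A0 shB shA dB dA ets leN' bB0 le_ts.
  rewrite !inE !xpair_eqE => /or3P[] /andP[/eqP et /eqP es]; move: est c_gt1 bA0 bB0;
    by rewrite es et => -[<-] // _ bA0 bB0; rewrite ?bA0 ?bB0 ?orbT.
rewrite negb_and => ndet.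
have {symm ndet} : [|| [&& c == 2 :> nat & boundary AA c 2 != set0],
        [&& c == 2 :> nat & boundary BB c 2 != set0] |
        [&& c == 3 :> nat, boundary AA c 2 != set0 & boundary BB c 2 != set0]].
  case/orP: ndet => [ndA|ndB].
    have [s bA0 leN] := boundary_of_not_determined uA shA dA ndA.
    have est : s + (c.+1 - s) = c.+1 by rewrite subnKC // leqW // (boundary_le bA0).
    exact: symm est bA0 (boundary_partner le_kl opt B0 shA dA est leN bA0).
  have le_lk : l + k <= n by rewrite addnC.
  have [t bB0 leN] := boundary_of_not_determined uB shB dB ndB.
  have ets : t + (c.+1 - t) = c.+1 by rewrite subnKC // leqW // (boundary_le bB0).
  have bA0 := boundary_partner le_lk optS A0 shB dB ets leN bB0.
  by rewrite addnC in ets; apply: symm ets bA0 bB0.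
case/or3P => [/andP[/eqP c2 bA0]|/andP[/eqP c2 bB0]|/and3P[/eqP c3 bA0 bB0]].
- exact: (level3_false hk hl k2 l2 opt shA c2 dA bA0).
- exact: (level3_false hl hk l2 k2 optS shB c2 dB bB0).
(* For [c = 3] both families are smaller than stars, against optimality. *)
have hvA := level4_heavy hk hl k2 l2 opt shA shB c3 dA dB bA0.
have hvB := level4_heavy hl hk l2 k2 optS shB shA c3 dB dA bB0.
have ltA := heavy4_lt hk (boundary_lt uA bA0) uA hvA.
have ltB := heavy4_lt hl (boundary_lt uB bB0) uB hvB.
by have := ltn_mul ltA ltB; rewrite ltnNge le_PQ.
Qed.

(** * The shift operator *)

Section Shift.
Variables (n : nat) (x y : 'I_n).
Implicit Types (A B : {set 'I_n}) (FF : {set {set 'I_n}}).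

(** The usual compression from [y] to [x]; in a family a set moves only if its image is not yet a
    member. *)
Definition shift A := if (y \in A) && (x \notin A) then x |: (A :\ y) else A.
Definition shift_in FF A := if shift A \in FF then A else shift A.
Definition shift_family FF := [set shift_in FF A | A in FF].

Lemma card_shift A : #|shift A| = #|A|.
Proof. by rewrite /shift; case: andP => // -[yA xA]; rewrite card_swap. Qed.

Lemma shift_inP FF A : A \in FF ->
  shift_in FF A = A \/
  [/\ y \in A, x \notin A, shift_in FF A = x |: (A :\ y) & x |: (A :\ y) \notin FF].
Proof.
move=> AF; rewrite /shift_in; case: ifPn => [_|]; first by left.
by rewrite /shift; case: andP => [[yA xA] nF|_]; [right | left].
Qed.

Lemma card_shift_family FF : #|shift_family FF| = #|FF|.
Proof.
apply: card_in_imset => A B AF BF.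
case: (shift_inP AF) => [->|[yA xA -> nA]]; case: (shift_inP BF) => [->|[yB xB -> nB]] //.
- by move=> eAB; rewrite -eAB AF in nB.
- by move=> eAB; rewrite eAB BF in nA.
move/(congr1 (fun E => y |: (E :\ x))); rewrite !setU1K ?inE ?(negbTE xA) ?(negbTE xB) ?andbF //.
by rewrite !setD1K.
Qed.

Lemma shift_family_uniform k FF :
  FF \subset ksubsets n k -> shift_family FF \subset ksubsets n k.
Proof.
move=> uF; apply/subsetP => _ /imsetP[A AF ->]; rewrite inE /shift_in.
by case: ifP; rewrite ?card_shift (card_ksubsets uF AF).
Qed.

(** If [x] is in [B], the intersection gains [x] and loses at most [y]; if neither is in [B],
    nothing is lost. Otherwise [B] stays because its image is in [BB], and that image meets [A] in
    as many points as [B] meets the image of [A]. *)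
Lemma shift_family_cross_moved AA BB A B : cross_intersecting 2 AA BB ->
  A \in AA -> B \in BB -> y \in A -> x \notin A -> shift_in BB B = B ->
  2 <= #|(x |: (A :\ y)) :&: B|.
Proof.
move=> cr AF BF yA xA eB.
have [xB|xB] := boolP (x \in B).
  apply: leq_trans (cr _ _ AF BF) _.
  have -> : (x |: A :\ y) :&: B = x |: ((A :&: B) :\ y).
    apply/setP => z; rewrite !inE; case: (eqVneq z x) => [->|_] /=; first by rewrite xB.
    by rewrite andbA.
  rewrite cardsU1 !inE (negbTE xA) andbF (cardsD1 y (A :&: B)) leq_add2r.
  by case: (_ \in _).
have [yB|yB] := boolP (y \in B); last first.
  apply: leq_trans (cr _ _ AF BF) _; apply/subset_leq_card/subsetP => z.
  rewrite !inE => /andP[zA zB]; rewrite zA zB !andbT orbC.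
  by rewrite (contraNneq _ yB) // => <-.
have shB : x |: (B :\ y) \in BB.
  have [_|[_ _ eB' nB]] := shift_inP BF.
    move: eB; rewrite /shift_in /shift yB xB /=; case: ifP => // _ /setP/(_ x).
    by rewrite !inE eqxx (negbTE xB).
  by move/setP/(_ x): eB; rewrite eB' !inE eqxx (negbTE xB).
have := cr _ _ AF shB; have -> // : A :&: (x |: B :\ y) = (x |: A :\ y) :&: B.
apply/setP => z; rewrite !inE; case: (eqVneq z x) => [->|_] /=.
  by rewrite (negbTE xA) (negbTE xB).
by rewrite andbCA andbA.
Qed.

Lemma shift_family_cross AA BB : cross_intersecting 2 AA BB ->
  cross_intersecting 2 (shift_family AA) (shift_family BB).
Proof.
move=> cr _ _ /imsetP[A AF ->] /imsetP[B BF ->].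
have [eA|[yA xA eA _]] := shift_inP AF; have [eB|[yB xB eB _]] := shift_inP BF.
- by rewrite eA eB cr.
- rewrite eA eB setIC.
  exact: (shift_family_cross_moved (cross_sym cr) BF AF yB xB eA).
- by rewrite eA; rewrite eB; apply: (shift_family_cross_moved cr AF BF).
rewrite eA eB; have -> : (x |: A :\ y) :&: (x |: B :\ y) = x |: ((A :&: B) :\ y).
  by rewrite -setUIr -setDIl.
by rewrite card_swap ?inE ?yA // ?(negbTE xA) // cr.
Qed.

Lemma shift_family_admissible k l AA BB :
  admissible k l AA BB -> admissible k l (shift_family AA) (shift_family BB).
Proof.
case=> uA uB cr; split; [exact: shift_family_uniform|exact: shift_family_uniform|].
exact: shift_family_cross.
Qed.

Lemma shift_family_optimal k l AA BB :
  optimal k l AA BB -> optimal k l (shift_family AA) (shift_family BB).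
Proof.
case=> adm max; split; first exact: shift_family_admissible.
by move=> AA' BB' /max; rewrite !card_shift_family.
Qed.

Definition weight FF := \sum_(A in FF) \sum_(a in A) (a : nat).

Lemma weight_shift_in FF A : x < y -> A \in FF ->
  \sum_(a in shift_in FF A) a + (shift_in FF A != A) <= \sum_(a in A) a.
Proof.
move=> ltxy AF; have [->|[yA xA -> _]] := shift_inP AF; first by rewrite eqxx addn0.
have -> : (x |: A :\ y) != A.
  by apply/eqP => /setP/(_ x); rewrite !inE eqxx (negbTE xA).
rewrite big_setU1 /=; last by rewrite inE (negbTE xA) andbF.
by rewrite [X in _ <= X](big_setD1 y) //= addn1 -addSn leq_add2r.
Qed.

Lemma shift_in_inj FF : {in FF &, injective (shift_in FF)}.
Proof. by apply/imset_injP; rewrite -/(shift_family FF) card_shift_family. Qed.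

(** The boolean counts as 0 or 1, so the weight drops strictly when the family changes. *)
Lemma weight_shift_family FF : x < y ->
  weight (shift_family FF) + (shift_family FF != FF) <= weight FF.
Proof.
move=> ltxy; rewrite /weight /shift_family (big_imset _ (@shift_in_inj FF)) /=.
have [fixF|] := boolP [forall A in FF, shift_in FF A == A].
  have -> : [set shift_in FF A | A in FF] = FF.
    rewrite -[RHS]imset_id; apply: eq_in_imset => A AF.
    by apply/eqP; move/forall_inP: fixF; apply.
  rewrite eqxx addn0; apply: leq_sum => A AF.
  by apply: leq_trans (weight_shift_in ltxy AF); rewrite leq_addr.
rewrite negb_forall_in => /exists_inP[A AF nA].
rewrite (bigD1 A) //= [X in _ <= X](bigD1 A) //= addnAC leq_add //.
  by apply: leq_trans (weight_shift_in ltxy AF); rewrite leq_add2l nA leq_b1.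
apply: leq_sum => B /andP[BF _].
by apply: leq_trans (weight_shift_in ltxy BF); rewrite leq_addr.
Qed.

Lemma shift_family_fixed FF A : shift_family FF = FF -> A \in FF ->
  y \in A -> x \notin A -> x |: (A :\ y) \in FF.
Proof.
move=> fixF AF yA xA; have [eA|[_ _ eA _]] := shift_inP AF.
  move: eA; rewrite /shift_in /shift yA xA /=; case: ifP => // _ /setP/(_ x).
  by rewrite !inE eqxx (negbTE xA).
by rewrite -eA -{2}fixF; apply/imsetP; exists A.
Qed.

End Shift.

Lemma shifted_or_lighter n (FF : {set {set 'I_n}}) :
  shifted FF \/
  exists x y : 'I_n, x < y /\ shift_family x y FF != FF.
Proof.
have [fixF|] := boolP [forall x : 'I_n, forall y : 'I_n, (x < y) ==> (shift_family x y FF == FF)].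
  left=> x y A ltxy AF yA xA; apply: shift_family_fixed => //.
  by move/forallP/(_ x)/forallP/(_ y)/implyP/(_ ltxy)/eqP: fixF.
rewrite negb_forall => /existsP[x]; rewrite negb_forall => /existsP[y].
by rewrite negb_imply => /andP[ltxy nF]; right; exists x, y.
Qed.

(** * Undoing a shift that produced a star *)

Section Unshift.
Variables (n k : nat) (x y u : 'I_n) (FF : {set {set 'I_n}}).
Hypotheses (neq_xu : x != u) (neq_yu : y != u).
Hypothesis shF : shift_family x y FF = star k [set x; u].
Let V := ~: [set x; y; u].

Lemma unshift_mem (A : {set 'I_n}) : A \in FF ->
  u \in A /\ (x \notin A -> y \in A /\ x |: (A :\ y) \notin FF).
Proof.
move=> AF; have : shift_in x y FF A \in star k [set x; u].
  by rewrite -shF; apply/imsetP; exists A.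
rewrite mem_star subUset !sub1set; have [->|[yA xA -> nF]] := shift_inP x y AF.
  by case/and3P=> _ -> ->.
case/and3P=> _ _; rewrite in_setU1 in_setD1 eq_sym (negbTE neq_xu) /=.
by case/andP=> _ uA.
Qed.

Lemma unshift_dichotomy (E : {set 'I_n}) : E \subset V -> #|E|.+2 = k ->
  (x |: (u |: E) \in FF) || (y |: (u |: E) \in FF).
Proof.
move=> sEV cE; have [xE yE uE] : [/\ x \notin E, y \notin E & u \notin E].
  by split; apply/negP => /(subsetP sEV); rewrite !inE eqxx ?orbT.
have xuE : x \notin u |: E by rewrite !inE negb_or neq_xu.
have : x |: (u |: E) \in shift_family x y FF.
  rewrite shF mem_star !cardsU1 xuE uE -cE eqxx setUA; exact: subsetUl.
case/imsetP=> A AF; have [->|[yA xA -> _]] := shift_inP x y AF; first by move->; rewrite AF.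
move/(congr1 (fun Z => Z :\ x)); rewrite !setU1K //; last by rewrite inE (negbTE xA) andbF.
by move->; rewrite setD1K // AF orbT.
Qed.
(** For [alpha] true, a member without [x] would contain [y] and [u] while its image is missing,
    against the hypothesis. For [alpha] false, a member without [y] contains [x] and [u], which the
    hypothesis forbids. *)
Lemma unshift_sub (alpha : bool) : FF \subset ksubsets n k ->
  (forall E : {set 'I_n}, E \subset V -> #|E|.+2 = k -> (x |: (u |: E) \in FF) = alpha) ->
  FF \subset star k [set if alpha then x else y; u].
Proof.
move=> uF aE; apply/subsetP => A AF; have [uA xA] := unshift_mem AF.
have cA := card_ksubsets uF AF.
rewrite mem_star subUset !sub1set cA eqxx uA andbT /=; apply: contraT => nA.
have sV p (Z : {set 'I_n}) : x \notin Z :\ p -> y \notin Z :\ p -> (Z :\ p) :\ u \subset V.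
  move=> xZ yZ; apply/subsetP => z; rewrite in_setD1 => /andP[zu zZ].
  rewrite !inE !negb_or zu andbT; apply/andP; split.
    by apply: contraNneq xZ => <-.
  by apply: contraNneq yZ => <-.
case: alpha aE nA => aE nA.
  have [yA nF] := xA nA; have := aE ((A :\ y) :\ u).
  have uAy : u \in A :\ y by rewrite in_setD1 eq_sym neq_yu.
  rewrite setD1K // (negbTE nF); apply.
    by apply: sV; rewrite in_setD1 ?eqxx // (negbTE nA) andbF.
  by rewrite -cA (cardsD1 y A) yA (cardsD1 u (A :\ y)) uAy.
have [xA'|/xA[yA _]] := boolP (x \in A); last by rewrite yA in nA.
have uAx : u \in A :\ x by rewrite in_setD1 eq_sym neq_xu.
have := aE ((A :\ x) :\ u); rewrite !setD1K // AF => e; suff : true = false by []; apply: e.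
  by apply: sV; rewrite in_setD1 ?eqxx // (negbTE nA) andbF.
by rewrite -cA (cardsD1 x A) xA' (cardsD1 u (A :\ x)) uAx.
Qed.

End Unshift.

(** Each [E] in [V] chooses [x] or [y]. For disjoint [E] and [F] opposite choices would give members
    meeting only in [u], so the choices agree; as the disjointness graph is connected, one choice
    holds throughout. *)
Lemma unshift_star n k l (x y u : 'I_n) (AA BB : {set {set 'I_n}}) :
  k + l <= n -> 1 < k -> 1 < l -> x != y -> x != u -> y != u ->
  admissible k l AA BB ->
  shift_family x y AA = star k [set x; u] -> shift_family x y BB = star l [set x; u] ->
  exists2 T : {set 'I_n}, #|T| = 2 & AA \subset star k T /\ BB \subset star l T.
Proof.
move=> le_kl k2 l2 xy xu yu [uA uB cr] shA shB.
set V := ~: [set x; y; u].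
have cV : #|V| = n - 3.
  have <- : #|[set x; y; u]| = 3.
    by rewrite setUC cardsU1 cards2 xy !inE negb_or [u == x]eq_sym [u == y]eq_sym xu yu.
  by apply/esym/eqP; rewrite -(eqn_add2l #|[set x; y; u]|) cardsC card_ord subnKC // -[X in _ <= X](card_ord n) max_card.
have meet1 p q (E F : {set 'I_n}) : p != q -> p \notin F -> q \notin E ->
    E :&: F = set0 -> #|(p |: (u |: E)) :&: (q |: (u |: F))| < 2.
  move=> pq pF qE EF; rewrite ltnS -(cards1 u) subset_leq_card //.
  apply/subsetP => z; rewrite !inE; case: (eqVneq z u) => //= _.
  case: (eqVneq z p) => [->|_] /=; first by rewrite (negbTE pq) (negbTE pF).
  case: (eqVneq z q) => [->|_] /=; first by rewrite (negbTE qE).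
  by move/setP/(_ z): EF; rewrite !inE => ->.
have slack j : j.+2 = k -> l - 2 <= n - 3 - j.+1.
  by move: le_kl k2 l2; clear; lia.
have sVP (Z : {set 'I_n}) : Z \subset V -> x \notin Z /\ y \notin Z.
  by move=> sZ; split; apply/negP => /(subsetP sZ); rewrite !inE eqxx ?orbT.
have disj (E F : {set 'I_n}) : E \subset V -> #|E|.+2 = k -> F \subset V -> #|F|.+2 = l ->
    E :&: F = set0 -> (x |: (u |: E) \in AA) = (x |: (u |: F) \in BB).
  move=> sE cE sF cF EF; have [xE yE] := sVP E sE; have [xF yF] := sVP F sF.
  have dA := unshift_dichotomy xu shA sE cE; have dB := unshift_dichotomy xu shB sF cF.
  apply/idP/idP => [aE|bF].
    move: dB; case: (_ \in BB) => //= b'F; have := cr _ _ aE b'F.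
    by rewrite leqNgt meet1.
  move: dA; case: (_ \in AA) => //= a'E; have := cr _ _ a'E bF.
  by rewrite leqNgt meet1 // eq_sym.
have fresh (E : {set 'I_n}) j : E \subset V -> j <= #|V| - #|E| ->
    exists F : {set 'I_n}, [/\ F \subset V, #|F| = j & E :&: F = set0].
  move=> sE lej; have [|F /andP[_ sF] cF] := @subset_between _ set0 (V :\: E) j (sub0set _).
    by rewrite cards0 cardsD (setIidPr sE).
  exists F; split=> //; first exact: subset_trans sF (subsetDl _ _).
  by apply/disjoint_setI0; rewrite disjoint_sym; case/subsetDP: sF.
(* Sets differing by one exchange have a union of size [k - 1], and [(k - 1) + (l - 2) <= n - 3]
   leaves room for an [F] disjoint from both. *)
have const (E E' : {set 'I_n}) : E \subset V -> #|E|.+2 = k -> E' \subset V -> #|E'|.+2 = k ->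
    (x |: (u |: E) \in AA) = (x |: (u |: E') \in AA).
  move=> sE cE sE' cE'; move: {2}#|E' :\: E| (erefl #|E' :\: E|) => d.
  elim: d E sE cE => [|d IHd] E sE cE cd.
    have -> // : E' = E; apply/eqP; rewrite eqEcard -setD_eq0 -cards_eq0 cd /=.
    by rewrite -ltnS -ltnS cE cE'.
  have /card_gt0P[e'] : 0 < #|E' :\: E| by rewrite cd.
  have /card_gt0P[e] : 0 < #|E :\: E'|.
    have eqEE : #|E| = #|E'| by apply/eqP; rewrite -eqSS -eqSS cE cE'.
    by move: cd; rewrite !cardsD setIC eqEE => ->.
  rewrite !inE => /andP[eE' eE] /andP[e'E e'E'].
  have sE1 : e' |: (E :\ e) \subset V.
    by rewrite subUset sub1set (subsetP sE') //= (subset_trans (subsetDl _ _)).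
  have sE2 : e' |: E \subset V by rewrite subUset sub1set (subsetP sE').
  have [|F [sF cF dF]] := fresh _ (l - 2) sE2.
    by rewrite cardsU1 e'E cV; apply: slack cE.
  have {}cF : #|F|.+2 = l by rewrite cF -addn2 subnK.
  have cE1 : #|e' |: (E :\ e)|.+2 = k by rewrite card_swap.
  have dis (Z : {set 'I_n}) : Z \subset e' |: E -> Z :&: F = set0.
    by move=> sZ; apply/eqP; rewrite -subset0 -dF setSI.
  rewrite (disj E F) ?dis ?subsetUr // -(disj (e' |: (E :\ e)) F) ?dis //; last first.
    by rewrite setUS // subsetDl.
  apply: IHd => //; have -> : E' :\: (e' |: E :\ e) = (E' :\: E) :\ e'.
    apply/setP => z; rewrite !inE; case: (eqVneq z e') => //= _.
    by case: (eqVneq z e) => [->|//] /=; rewrite (negbTE eE') andbF.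
  by move: cd; rewrite (cardsD1 e') !inE e'E e'E' => -[].
have [|E0 [sE0 cE0 _]] := fresh set0 (k - 2) (sub0set _).
  by rewrite cards0 cV subn0; move: le_kl k2 l2; clear; lia.
have {}cE0 : #|E0|.+2 = k by rewrite cE0 -addn2 subnK.
set alpha := x |: (u |: E0) \in AA.
have aE (E : {set 'I_n}) : E \subset V -> #|E|.+2 = k -> (x |: (u |: E) \in AA) = alpha.
  by move=> sE cE; apply: const.
have bF (F : {set 'I_n}) : F \subset V -> #|F|.+2 = l -> (x |: (u |: F) \in BB) = alpha.
  move=> sF cF; have [|E [sE cE dE]] := fresh F (k - 2) sF.
    by rewrite cV; move: le_kl k2 l2 cF; clear; move: #|F| => j; lia.
  have {}cE : #|E|.+2 = k by rewrite cE -addn2 subnK.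
  by rewrite -(disj E F) ?aE // setIC.
exists [set if alpha then x else y; u].
  by rewrite cards2; case: (alpha); rewrite ?xu ?yu.
split; first exact: (unshift_sub xu yu shA uA aE).
exact: (unshift_sub xu yu shB uB bF).
Qed.

(** A moved set has lost [y], so if its image contains [T] then [x] is not in [T], and the set
    itself contains [T]. *)
Lemma unshift_same n k (x y : 'I_n) (FF : {set {set 'I_n}}) (T : {set 'I_n}) :
  (x \in T -> y \in T) -> FF \subset ksubsets n k ->
  shift_family x y FF = star k T -> FF \subset star k T.
Proof.
move=> xyT uF shF; apply/subsetP => A AF; rewrite mem_star (card_ksubsets uF AF) eqxx /=.
have : shift_in x y FF A \in star k T by rewrite -shF; apply/imsetP; exists A.
rewrite mem_star => /andP[_]; have [->//|[yA xA -> _]] := shift_inP x y AF.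
move=> sT; apply/subsetP => z zT; have := subsetP sT z zT.
rewrite !inE => /orP[/eqP zx|/andP[//]].
have := subsetP sT y; rewrite -zx in xyT; move/(_ (xyT zT)).
by rewrite !inE eqxx orbF => /eqP yx; rewrite zx -yx.
Qed.

(** Induction on the total weight: a shift that changes the pair gives a lighter optimal pair, hence
    stars, and the shift is undone. Only a centre containing [x] but not [y] requires
    [unshift_star]. *)
Lemma optimal_star n k l (AA BB : {set {set 'I_n}}) :
  338 * k <= 100 * n -> 338 * l <= 100 * n -> 1 < k -> 1 < l ->
  optimal k l AA BB ->
  exists2 T : {set 'I_n}, #|T| = 2 & AA = star k T /\ BB = star l T.
Proof.
move=> hk hl k2 l2; have [w] := ubnP (weight AA + weight BB).
elim: w AA BB => // w IHw AA BB lt_w opt; have le_kl : k + l <= n by lia.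
have [PQ0 le_PQ A0 B0] := opt_gt0 hk hl k2 l2 opt.
have [[uA uB cr] _] := opt.
have lift (x y : 'I_n) : x < y ->
    (shift_family x y AA != AA) || (shift_family x y BB != BB) ->
    exists2 T : {set 'I_n}, #|T| = 2 & AA = star k T /\ BB = star l T.
  move=> ltxy neq; have xy : x != y by apply: contraTneq ltxy => ->; rewrite ltnn.
  suff [T cT [sA sB]] : exists2 T : {set 'I_n}, #|T| = 2 &
      AA \subset star k T /\ BB \subset star l T.
    by exists T => //; apply: star_of_sub => //; rewrite PQ0.
  have [||T cT [eA eB]] := IHw (shift_family x y AA) (shift_family x y BB).
  - have := weight_shift_family AA ltxy; have := weight_shift_family BB ltxy.
    case: (_ =P AA) neq; case: (_ =P BB) => //= _ _ _; lia.
  - exact: shift_family_optimal.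
  have [/andP[xT yT]|nxy] := boolP ((x \in T) && (y \notin T)); last first.
    have xyT : x \in T -> y \in T.
      by move=> xT; move: nxy; rewrite xT /= negbK.
    by exists T => //; split; [apply: unshift_same xyT uA eA|apply: unshift_same xyT uB eB].
  have /cards1P[u eu] : #|T :\ x| == 1 by move: cT; rewrite (cardsD1 x) xT add1n => -[->].
  have eT : T = [set x; u] by rewrite -(setD1K xT) eu.
  have uTx : u \in T :\ x by rewrite eu set11.
  have xu : x != u by move: uTx; rewrite in_setD1 eq_sym => /andP[].
  have yu : y != u by apply: contraNneq yT => ->; rewrite eT set22.
  rewrite eT in eA eB.
  exact: (unshift_star le_kl k2 l2 xy xu yu opt.1 eA eB).
have [shA|[x [y [ltxy nA]]]] := shifted_or_lighter AA; last first.
  by apply: lift ltxy _; rewrite nA.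
have [shB|[x [y [ltxy nB]]]] := shifted_or_lighter BB; last first.
  by apply: lift ltxy _; rewrite nB orbT.
exact: shifted_optimal_star.
Qed.

(** * Existence of an optimal pair and the theorem *)

Lemma exists_optimal n k l : exists AA BB : {set {set 'I_n}}, optimal k l AA BB.
Proof.
pose ok (p : {set {set 'I_n}} * {set {set 'I_n}}) :=
  [&& p.1 \subset ksubsets n k, p.2 \subset ksubsets n l &
      [forall A in p.1, forall B in p.2, 2 <= #|A :&: B|]].
have okP p : reflect (admissible k l p.1 p.2) (ok p).
  apply: (iffP and3P) => -[uA uB cr]; split=> //.
    by move=> A B AF BF; move/forall_inP/(_ A AF)/forall_inP: cr; apply.
  by apply/forall_inP => A AF; apply/forall_inP => B; apply: cr.
have ok0 : ok (set0, set0).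
  by apply/okP; split; rewrite ?sub0set // => A B; rewrite inE.
case: (arg_maxnP (fun p : {set {set 'I_n}} * {set {set 'I_n}} => #|p.1| * #|p.2|) ok0) => -[AA BB] /okP adm max.
by exists AA, BB; split=> // AA' BB' adm'; apply: (max (AA', BB')); apply/okP.
Qed.

Import Order.TTheory GRing.Theory Num.Theory.

Lemma nat_of_ratio_le (a b m n : nat) : 0 < b ->
  (a%:R / b%:R * m%:R <= n%:R :> rat)%R -> a * m <= b * n.
Proof.
move=> b0; rewrite mulrAC ler_pdivrMr ?ltr0n // -!natrM ler_nat.
by rewrite [n * b]mulnC.
Qed.

Theorem theorem1p4 (n k l : nat) (AA BB : {set {set 'I_n}})
    (hn : 0 < n) (hk : 2 <= k) (hl : 2 <= l)
    (hnkl : (338%:R / 100%:R * (maxn k l)%:R <= n%:R :> rat)%R)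
    (hAA : AA \subset ksubsets n k) (hBB : BB \subset ksubsets n l)
    (hcross : cross_intersecting 2 AA BB) :
  #|AA| * #|BB| <= 'C(n - 2, k - 2) * 'C(n - 2, l - 2) /\
  (#|AA| * #|BB| = 'C(n - 2, k - 2) * 'C(n - 2, l - 2) <->
   exists T : {set 'I_n},
     [/\ #|T| = 2,
         AA = [set A in ksubsets n k | T \subset A] &
         BB = [set B in ksubsets n l | T \subset B]]).
Proof.
have hmax := @nat_of_ratio_le 338 100 (maxn k l) n isT hnkl.
clear hnkl.
have [bk bl] : 338 * k <= 100 * n /\ 338 * l <= 100 * n by lia.
have cards (T : {set 'I_n}) : #|T| = 2 ->
    #|star k T| * #|star l T| = 'C(n - 2, k - 2) * 'C(n - 2, l - 2) :> nat.
  by move=> cT; rewrite !card_star cT.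
(* Some optimal pair exists and consists of stars, which determines the maximum; any pair attaining
   it is then optimal itself. *)
have [A0 [B0 opt0]] := exists_optimal n k l.
have [T0 cT0 [eA0 eB0]] := optimal_star bk bl hk hl opt0.
have max (AA' BB' : {set {set 'I_n}}) : admissible k l AA' BB' ->
    #|AA'| * #|BB'| <= 'C(n - 2, k - 2) * 'C(n - 2, l - 2).
  by rewrite -(cards T0 cT0) -eA0 -eB0; apply: opt0.2.
split; first exact: max.
split=> [eq_max|[T [cT -> ->]]]; last exact: (cards T cT).
have opt : optimal k l AA BB by split=> // AA' BB'; rewrite eq_max; apply: max.
by have [T cT [eA eB]] := optimal_star bk bl hk hl opt; exists T.
Qed.
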